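(* (i) There exist $\mathbf{a},\mathbf{b}\in\mathbf{N}_{\geq2}^{\infty}$, and states $\omega\in\mathcal{S}(\mathcal{A}(\mathbf{a}))$ and $\omega'\in\mathcal{S}(\mathcal{A}(\mathbf{b}))$ such that $\omega\otimes_{\varphi}\omega'\neq\omega'\otimes_{\varphi}\omega$. (ii) There exist $\mathbf{a},\mathbf{b}\in\mathbf{N}_{\geq2}^{\infty}$, and classes $[\pi]\in\mathsf{R}_{\mathbf{a}}$ and $[\pi']\in\mathsf{R}_{\mathbf{b}}$ such that $[\pi]\otimes_{\varphi}[\pi']\neq[\pi']\otimes_{\varphi}[\pi]$.
   Context: $\mathbf{N}_{\geq2}^{\infty}$ is the set of all sequences in $\{2,3,4,\ldots\}$, with commutative product $\mathbf{a}\cdot\mathbf{b}=(a_1b_1,a_2b_2,\ldots)$. $M_n$ is the algebra of $n\times n$ complex matrices with standard matrix units $E^{(n)}_{i,j}$. For $\mathbf{a}=(a_1,a_2,\ldots)\in\mathbf{N}_{\geq2}^{\infty}$, $\mathcal{A}(\mathbf{a})$ is the C$^*$-inductive limit of $\bigotimes_{j=1}^nM_{a_j}$ under the embeddings $A\mapsto A\otimes I$. Tensor products of C$^*$-algebras are minimal. $\mathcal{S}(\mathcal{A}(\mathbf{a}))$ is the set of states of $\mathcal{A}(\mathbf{a})$, and $\mathsf{R}_{\mathbf{a}}$ is the set of unitary equivalence classes of $*$-representations of $\mathcal{A}(\mathbf{a})$. $\varphi_{\mathbf{a},\mathbf{b}}:\mathcal{A}(\mathbf{a}\cdot\mathbf{b})\to\mathcal{A}(\mathbf{a})\otimes\mathcal{A}(\mathbf{b})$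 is the unique $*$-isomorphism such that for all $n\geq1$ and $j_i,k_i\in\{1,\ldots,a_ib_i\}$, $$\varphi_{\mathbf{a},\mathbf{b}}(E^{(a_1b_1)}_{j_1,k_1}\otimes\cdots\otimes E^{(a_nb_n)}_{j_n,k_n})=(E^{(a_1)}_{j_1',k_1'}\otimes\cdots\otimes E^{(a_n)}_{j_n',k_n'})\otimes(E^{(b_1)}_{j_1'',k_1''}\otimes\cdots\otimes E^{(b_n)}_{j_n'',k_n''}),$$ where $j_i=b_i(j_i'-1)+j_i''$, $k_i=b_i(k_i'-1)+k_i''$ with $j_i',k_i'\in\{1,\ldots,a_i\}$, $j_i'',k_i''\in\{1,\ldots,b_i\}$. For states $\rho_1$ of $\mathcal{A}(\mathbf{a})$ and $\rho_2$ of $\mathcal{A}(\mathbf{b})$, $\rho_1\otimes_{\varphi}\rho_2=(\rho_1\otimes\rho_2)\circ\varphi_{\mathbf{a},\mathbf{b}}$, a state of $\mathcal{A}(\mathbf{a}\cdot\mathbf{b})$. For $*$-representations $\pi_1$ of $\mathcal{A}(\mathbf{a})$ and $\pi_2$ of $\mathcal{A}(\mathbf{b})$, $\pi_1\otimes_{\varphi}\pi_2=(\pi_1\otimes\pi_2)\circ\varphi_{\mathbf{a},\mathbf{b}}$, a representation of $\mathcal{A}(\mathbf{a}\cdot\mathbf{b})$, and $[\pi_1]\otimes_{\varphi}[\pi_2]=[\pi_1\otimes_{\varphi}\pi_2]$ (well defined on unitary equivalence classes). *)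

(* Defs.v *)
From HB Require Import structures.
From mathcomp Require Import all_boot all_order all_algebra.
From mathcomp Require Import all_classical all_reals all_analysis.
From mathcomp Require Import complex mxtens.

Set Implicit Arguments.
Unset Strict Implicit.
Unset Printing Implicit Defensive.

Import Order.TTheory GRing.Theory Num.Theory.
Import numFieldNormedType.Exports.

Local Open Scope classical_set_scope.
Local Open Scope sesquilinear_scope.
Local Open Scope ring_scope.

(* Unital (nonzero) complex C*-algebras. The norm is a separate real-valued
   function: MathComp-Analysis has no structure joining rings and normed
   modules. Homogeneity and the other norm axioms are stated here, and
   completeness is convergence of Cauchy sequences. *)
HB.mixin Record isCStar (R : realType) (A : Type) & GRing.Algebra R[i] A := {
  cnorm : A -> R;
  star : A -> A;
  cnorm_eq0 : forall x, cnorm x = 0 -> x = 0;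
  cnormD : forall x y, cnorm (x + y) <= cnorm x + cnorm y;
  cnormZ : forall (c : R[i]) x, cnorm (c *: x) = complex.Re `|c| * cnorm x;
  cnormM : forall x y, cnorm (x * y) <= cnorm x * cnorm y;
  cnorm_complete : forall u : nat -> A,
    (forall e : R, 0 < e -> exists N, forall m n : nat,
        (N <= m)%N -> (N <= n)%N -> cnorm (u m - u n) < e) ->
    exists l : A, forall e : R, 0 < e -> exists N, forall n : nat,
        (N <= n)%N -> cnorm (u n - l) < e;
  starK : involutive star;
  starD : forall x y, star (x + y) = star x + star y;
  starZ : forall (c : R[i]) x, star (c *: x) = c^* *: star x;
  starM : forall x y, star (x * y) = star y * star x;
  cnorm_star : forall x, cnorm (star x * x) = cnorm x ^+ 2;
}.

#[short(type="cstarAlgType")]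
HB.structure Definition CStarAlgebra (R : realType) :=
  { A of GRing.Algebra R[i] A & isCStar R A }.

(* Complex Hilbert spaces; the inner product is linear in its second argument
   and conjugate-linear in the first. *)
HB.mixin Record isHilbert (R : realType) (H : Type)
    & CompleteNormedModule R[i] H := {
  dot : H -> H -> R[i];
  dotDr : forall u v w, dot u (v + w) = dot u v + dot u w;
  dotZr : forall (c : R[i]) u v, dot u (c *: v) = c * dot u v;
  dotC : forall u v, dot v u = (dot u v)^*;
  dot_norm : forall u : H, dot u u = `|u| ^+ 2;
}.

#[short(type="hilbertType")]
HB.structure Definition Hilbert (R : realType) :=
  { H of CompleteNormedModule R[i] H & isHilbert R H }.

Section CStarNotions.
Context {R : realType}.
Implicit Types A B : cstarAlgType R.

Definition is_state A (rho : A -> R[i]) : Prop :=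
  [/\ scalar rho, forall x, 0 <= rho (star x * x) & rho 1 = 1].

(* Unital *-homomorphisms from A to the algebra B(H) of bounded (i.e.
   continuous) linear operators on a Hilbert space H. *)
Record rep A := Rep {
  rep_space : hilbertType R;
  rep_op :> A -> {linear rep_space -> rep_space};
  rep_continuous : forall x, continuous (rep_op x);
  rep_linear : forall (c : R[i]) x y u,
    rep_op (c *: x + y) u = c *: rep_op x u + rep_op y u;
  rep_mul : forall x y u, rep_op (x * y) u = rep_op x (rep_op y u);
  rep_one : forall u, rep_op 1 u = u;
  rep_star : forall x u v, dot (rep_op (star x) u) v = dot u (rep_op x v) }.

Definition faithful A (pi : rep A) : Prop :=
  forall x, (forall u, pi x u = 0) -> x = 0.

Definition unitary_equiv A (pi sigma : rep A) : Prop :=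
  exists U : {linear rep_space pi -> rep_space sigma},
    [/\ bijective U,
        forall u v, dot (U u) (U v) = dot u v
      & forall x u, U (pi x u) = sigma x (U u)].

(* The class [pi], as a predicate: rep A is too large for classical_sets'
   set. *)
Definition rep_class A (pi : rep A) : rep A -> Prop :=
  fun sigma => unitary_equiv pi sigma.

(* C is an element of the set of unitary equivalence classes. *)
Definition is_rep_class A (C : rep A -> Prop) : Prop :=
  exists pi, C = rep_class pi.

Record star_iso A B := StarIso {
  iso_fun :> {lrmorphism A -> B};
  iso_star : forall x, iso_fun (star x) = star (iso_fun x);
  iso_bij : bijective iso_fun }.

Section Pullback.
Variables (A B : cstarAlgType R) (f : star_iso A B) (pi : rep B).

Definition pullback_op (x : A) : {linear rep_space pi -> rep_space pi} :=
  pi (f x).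

Fact pullback_continuous x : continuous (pullback_op x).
Proof. exact: rep_continuous. Qed.

Fact pullback_linear (c : R[i]) x y u :
  pullback_op (c *: x + y) u = c *: pullback_op x u + pullback_op y u.
Proof. by rewrite /pullback_op linearP rep_linear. Qed.

Fact pullback_mul x y u :
  pullback_op (x * y) u = pullback_op x (pullback_op y u).
Proof. by rewrite /pullback_op rmorphM rep_mul. Qed.

Fact pullback_one u : pullback_op 1 u = u.
Proof. by rewrite /pullback_op rmorph1 rep_one. Qed.

Fact pullback_star x u v :
  dot (pullback_op (star x) u) v = dot u (pullback_op x v).
Proof. by rewrite /pullback_op iso_star rep_star. Qed.

(* pi \o f *)
Definition rep_comp : rep A :=
  Rep pullback_continuous pullback_linear pullback_mul pullback_one
      pullback_star.

End Pullback.

(* L, together with the map (u, v) |-> t u v, is the Hilbert space tensor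
   product of H and K; this determines (L, t) up to a unique unitary. *)
Definition is_hilbert_tensor (H K L : hilbertType R) (t : H -> K -> L) : Prop :=
  [/\ forall v, linear (t^~ v),
      forall u, linear (t u),
      forall u v u' v', dot (t u v) (t u' v') = dot u u' * dot v v'
    & dense [set w | exists s : seq (H * K), w = \sum_(p <- s) t p.1 p.2]].

(* sigma is pi1 (x) pi2, i.e. sigma(x (x) y)(u (x) v) = pi1(x)u (x) pi2(y)v,
   for the elementary tensors x (x) y := tens x y of T. *)
Definition is_tensor_rep A B (T : cstarAlgType R) (tens : A -> B -> T)
    (pi1 : rep A) (pi2 : rep B) (sigma : rep T) : Prop :=
  exists t : rep_space pi1 -> rep_space pi2 -> rep_space sigma,
    is_hilbert_tensor t /\
    forall x y u v, sigma (tens x y) (t u v) = t (pi1 x u) (pi2 y v).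

(* The minimal (spatial) tensor product of A and B: the completion of the
   algebraic tensor product for the norm it inherits from B(H (x) K), where A
   and B are faithfully represented on H and K. As an injective *-homomorphism
   is isometric, the norm is described by mt_spatial, which also implies that
   the algebraic tensor product embeds in mt_alg. *)
Record min_tensor A B := MinTensor {
  mt_alg :> cstarAlgType R;
  mt_tens : A -> B -> mt_alg;
  mt_linearl : forall y, linear (mt_tens^~ y);
  mt_linearr : forall x, linear (mt_tens x);
  mt_mul : forall x x' y y',
    mt_tens x y * mt_tens x' y' = mt_tens (x * x') (y * y');
  mt_one : mt_tens 1 1 = 1;
  mt_star : forall x y, star (mt_tens x y) = mt_tens (star x) (star y);
  mt_dense : forall (z : mt_alg) (e : R), 0 < e ->
    exists s : seq (A * B), cnorm (z - \sum_(p <- s) mt_tens p.1 p.2) < e;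
  mt_spatial : exists (pi1 : rep A) (pi2 : rep B) (sigma : rep mt_alg),
    [/\ faithful pi1, faithful pi2, faithful sigma
      & is_tensor_rep mt_tens pi1 pi2 sigma] }.

(* sigma is rho1 (x) rho2. *)
Definition is_product_state A B (T : min_tensor A B)
    (rho1 : A -> R[i]) (rho2 : B -> R[i]) (sigma : T -> R[i]) : Prop :=
  is_state sigma /\ forall x y, sigma (mt_tens T x y) = rho1 x * rho2 y.

End CStarNotions.

(* Sequences are indexed from 0. *)
Record seq_ge2 := SeqGe2 {
  seq_ge2_val :> nat -> nat;
  seq_ge2P : forall i, (2 <= seq_ge2_val i)%N }.

Fact muls_subproof (a b : seq_ge2) i : (2 <= a i * b i)%N.
Proof. exact: (@leq_mul 2 1) (seq_ge2P a i) (ltnW (seq_ge2P b i)). Qed.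

Definition muls (a b : seq_ge2) : seq_ge2 := SeqGe2 (muls_subproof a b).

Lemma mulsC (a b : seq_ge2) : muls a b = muls b a.
Proof.
suff eq_seq (f g : nat -> nat) (Hf : forall i, (2 <= f i)%N)
    (Hg : forall i, (2 <= g i)%N) : f = g -> SeqGe2 Hf = SeqGe2 Hg.
  by apply: eq_seq; apply/funext => i; rewrite mulnC.
by move=> fg; case: _ / fg Hg => Hg; congr SeqGe2; exact: Prop_irrelevance.
Qed.

(* a_1 ... a_n, so that M_{a_1} (x) ... (x) M_{a_n} is 'M_(dimt a n). *)
Fixpoint dimt (a : nat -> nat) (n : nat) : nat :=
  if n is m.+1 then (dimt a m * a m)%N else 1%N.

(* X_1 (x) ... (x) X_n *)
Fixpoint tensn (R : realType) (a : nat -> nat)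
    (X : forall i, 'M[R[i]]_(a i)) (n : nat) : 'M[R[i]]_(dimt a n) :=
  if n is m.+1 then tensn X m *t X m else 1%:M.

(* The C*-inductive limit of the M_{a_1} (x) ... (x) M_{a_n} along
   X |-> X (x) 1. *)
Record uhf (R : realType) (a : seq_ge2) := UHF {
  uhf_alg :> cstarAlgType R;
  uhf_in : forall n, {linear 'M[R[i]]_(dimt a n) -> uhf_alg};
  uhf_in_mul : forall n (X Y : 'M[R[i]]_(dimt a n)),
    uhf_in n (X *m Y) = uhf_in n X * uhf_in n Y;
  uhf_in_one : forall n, uhf_in n 1%:M = 1;
  uhf_in_star : forall n (X : 'M[R[i]]_(dimt a n)),
    uhf_in n (X ^t*) = star (uhf_in n X);
  uhf_in_inj : forall n, injective (uhf_in n);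
  uhf_in_compat : forall n (X : 'M[R[i]]_(dimt a n)),
    uhf_in n.+1 (X *t (1%:M : 'M[R[i]]_(a n))) = uhf_in n X;
  uhf_dense : forall (x : uhf_alg) (e : R), 0 < e ->
    exists n (X : 'M[R[i]]_(dimt a n)), cnorm (x - uhf_in n X) < e }.

(* The isomorphism varphi_{a,b}. With indices starting at 0, the rule
   j = b (j' - 1) + j'' becomes j = j' * b + j'', which is the value of
   mxtens_index (j', j''). *)
Record phi_iso (R : realType) (a b : seq_ge2) (Aa : uhf R a) (Ab : uhf R b)
    (Aab : uhf R (muls a b)) (T : min_tensor Aa Ab) := PhiIso {
  phi_fun :> star_iso Aab T;
  phiE : forall n (j' k' : forall i, 'I_(a i)) (j'' k'' : forall i, 'I_(b i)),
    phi_fun (uhf_in Aab n (@tensn R (muls a b) (fun i =>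
       delta_mx (mxtens_index (j' i, j'' i)) (mxtens_index (k' i, k'' i))) n)) =
    mt_tens T
      (uhf_in Aa n (@tensn R a (fun i => delta_mx (j' i) (k' i)) n))
      (uhf_in Ab n (@tensn R b (fun i => delta_mx (j'' i) (k'' i)) n)) }.

Section PhiProducts.
Context {R : realType} {a b : seq_ge2} {Aa : uhf R a} {Ab : uhf R b}.
Context {Aab : uhf R (muls a b)} {T : min_tensor Aa Ab}.
Variable phi : phi_iso Aab T.

(* tau is the state rho1 (x)_varphi rho2. *)
Definition is_phi_state (rho1 : Aa -> R[i]) (rho2 : Ab -> R[i])
    (tau : Aab -> R[i]) : Prop :=
  exists2 sigma : T -> R[i],
    is_product_state rho1 rho2 sigma & tau = sigma \o phi.

(* C1 (x)_varphi C2, for classes C1 and C2: the representations equivalent to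
   pi1 (x)_varphi pi2 for some pi1 in C1 and pi2 in C2. *)
Definition phi_class (C1 : rep Aa -> Prop) (C2 : rep Ab -> Prop)
    : rep Aab -> Prop :=
  fun tau => exists (pi1 : rep Aa) (pi2 : rep Ab) (sigma : rep T),
    [/\ C1 pi1, C2 pi2, is_tensor_rep (mt_tens T) pi1 pi2 sigma
      & unitary_equiv (rep_comp phi sigma) tau].

End PhiProducts.

(* Main.v *)
Require Import Defs.
From HB Require Import structures.
From mathcomp Require Import all_boot all_order all_algebra.
From mathcomp Require Import all_classical all_reals all_analysis.
From mathcomp Require Import complex mxtens perm ring lra.

Set Implicit Arguments.
Unset Strict Implicit.
Unset Printing Implicit Defensive.

Import Order.TTheory GRing.Theory Num.Theory.
Import numFieldNormedType.Exports.

Local Open Scope classical_set_scope.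
Local Open Scope ring_scope.

(** Both parts hold already for a = b = (2, 2, 2, ...), where the two products to
    be compared live on the same algebra A(4, 4, 4, ...).

    A digit sequence e gives a product representation pi_e of A(a): the algebra
    acts on the Hilbert space with orthonormal basis the digit sequences x that
    eventually coincide with e, a matrix of the first n tensor factors acting on
    the first n digits. Put p_n = E_{e_1,e_1} (x) ... (x) E_{e_n,e_n}. Then p_n
    fixes the basis vector delta_e for every n, but it kills delta_x as soon as
    x differs from e among its first n digits. Now let e = 000... and
    e' = 111..., with projections p_n and q_n.

    The product pi_e (x)_phi pi_e' acts in the same way on the Hilbert space with
    basis the pairs of sequences ([product_repP]); in it, delta_e (x) delta_e' is
    fixed by all p_n (x) q_n. For the states, take the vector states of delta_e
    and delta_e': on p_1 (x) q_1 one product takes the value 1 and the other the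
    value 0. For the representations, suppose that rho_1 is equivalent to pi_e',
    and that a vector w of rho_1 (x) rho_2 is fixed by all p_n (x) q_n. Then
    <w, u (x) v> = <w, p_n u (x) q_n v>, and p_n u = 0 for large n when u
    corresponds to a basis vector; hence w is orthogonal to all elementary
    tensors, and w = 0 ([no_product_vector]). So pi_e' (x)_phi pi_e has no
    nonzero vector that could correspond to delta_e (x) delta_e'.

    Most of the work is to show that these representations exist. The Hilbert
    spaces are spaces of square-summable functions ([ell2]), with an inner
    product given by unconditional sums. The action of the matrices extends to
    the inductive limit because it is contractive for the norm of A(a)
    ([lrep_contractive], [rep_ext]). The formula that defines a tensor product of
    representations is checked on matrix units; it extends to all elements
    because every representation is contractive ([rep_contractive],
    [intertwine]). Both contractivity statements come from the same source: if h
    is self-adjoint and |h| < 1, then the iteration y |-> (h + y^2) / 2 converges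
    to some y with (1 - y)^2 = 1 - h, so 1 - h is a positive element. *)

Local Notation "x %:C" := (real_complex _ x) : ring_scope.
Local Notation Re := complex.Re.
Local Notation Im := complex.Im.

(** * Inner products *)

Section InnerProduct.
Variables (K : numClosedFieldType) (V : lmodType K) (d : V -> V -> K).
Hypothesis dD : forall u v w, d u (v + w) = d u v + d u w.
Hypothesis dZ : forall c u v, d u (c *: v) = c * d u v.
Hypothesis dC : forall u v, d v u = (d u v)^*.

Lemma form0r u : d u 0 = 0.
Proof. by rewrite -(scale0r 0) dZ mul0r. Qed.

Lemma formDl u v w : d (u + v) w = d u w + d v w.
Proof. by rewrite dC dD rmorphD /= -!dC. Qed.

Lemma formZl c u v : d (c *: u) v = c^* * d u v.
Proof. by rewrite dC dZ rmorphM /= -dC. Qed.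

Lemma formNr u v : d u (- v) = - d u v.
Proof. by rewrite -scaleN1r dZ mulN1r. Qed.

Lemma formNl u v : d (- u) v = - d u v.
Proof. by rewrite -scaleN1r formZl rmorphN1 mulN1r. Qed.

Hypothesis d_ge0 : forall u, 0 <= d u u.
Hypothesis d_eq0 : forall u, d u u = 0 -> u = 0.

Lemma form_CauchySchwarz u v : `|d u v| ^+ 2 <= d u u * d v v.
Proof.
have [-> | v_neq0] := eqVneq v 0; first by rewrite !form0r normr0 expr0n mulr0.
have dv_gt0 : 0 < d v v.
  by rewrite lt_def d_ge0 andbT; apply: contra v_neq0 => /eqP/d_eq0->.
have /= := d_ge0 (d v v *: u - d v u *: v).
rewrite !(dD, formDl, formNr, formNl, dZ, formZl) -!dC.
rewrite [X in 0 <= X](_ : _ = d v v * (d u u * d v v - d u v * d v u)); last by ring.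
by rewrite pmulr_rge0// subr_ge0 [d v u]dC normCK.
Qed.

Lemma form_triangle u v :
  sqrtC (d (u + v) (u + v)) <= sqrtC (d u u) + sqrtC (d v v).
Proof.
rewrite -(ler_pXn2r (n := 2)) ?nnegrE ?addr_ge0 ?sqrtC_ge0//.
rewrite sqrrD !sqrtCK dD !formDl.
suff h : d u v + d v u <= sqrtC (d u u) * sqrtC (d v v) *+ 2.
  have -> : d u u + d v u + (d u v + d v v) = d u u + (d u v + d v u) + d v v.
    by ring.
  by rewrite lerD2r lerD2l.
have le_n : `|d u v| <= sqrtC (d u u) * sqrtC (d v v).
  rewrite -(ler_pXn2r (n := 2)) ?nnegrE ?mulr_ge0 ?sqrtC_ge0// exprMn !sqrtCK.
  exact: form_CauchySchwarz.
apply: (@le_trans _ _ (`|d u v + d v u|)).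
  by rewrite real_ler_norm// CrealE rmorphD /= -!dC addrC.
rewrite (le_trans (ler_normD _ _))// [d v u]dC norm_conjC mulr2n.
exact: lerD.
Qed.

End InnerProduct.

(** * Unconditional sums *)

Section RealSums.
Context {R : realType} {I : choiceType}.
Implicit Types (h k : I -> R).

Definition abs_summable h := summable [set: I] (fun i => (h i)%:E).

(** The sum of a family that need not be nonnegative, as the difference of
    two suprema of finite partial sums. It is meaningful for absolutely
    summable families only. *)
Definition rsum h : R :=
  fine (\esum_(i in [set: I]) (fun i => (h i)%:E)^\+ i)%E -
  fine (\esum_(i in [set: I]) (fun i => (h i)%:E)^\- i)%E.

Lemma abs_summable_le h k :
  (forall i, `|h i| <= `|k i|) -> abs_summable k -> abs_summable h.
Proof.
move=> hk; apply: le_lt_trans; apply: le_esum => i _.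
by rewrite !abse_EFin lee_fin.
Qed.

Lemma abs_summableD h k :
  abs_summable h -> abs_summable k -> abs_summable (fun i => h i + k i).
Proof. exact: summableD. Qed.

Lemma esum_fin h : (forall i, 0 <= h i) -> abs_summable h ->
  (\esum_(i in [set: I]) (h i)%:E \is a fin_num)%E.
Proof.
move=> h0; rewrite /abs_summable summableE.
by congr (_ \is a fin_num); apply: eq_esum => i _; rewrite abse_EFin ger0_norm.
Qed.

Lemma rsumB h k : abs_summable h -> abs_summable k ->
  (forall i, 0 <= h i) -> (forall i, 0 <= k i) ->
  rsum (fun i => h i - k i) =
  fine (\esum_(i in [set: I]) (h i)%:E)%E - fine (\esum_(i in [set: I]) (k i)%:E)%E.
Proof.
move=> sh sk h0 k0; rewrite /rsum.
have s := summableB sh sk.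
have sp := summable_funepos s; have sn := summable_funeneg s.
have fE (f : I -> \bar R) : (forall i, (0 <= f i)%E) -> summable [set: I] f ->
    (\esum_(i in [set: I]) f i \is a fin_num)%E.
  move=> f0; rewrite summableE.
  by congr (_ \is a fin_num); apply: eq_esum => i _; rewrite gee0_abs.
have := @esumB R I [set: I] (EFin \o h) (EFin \o k) sh sk
  (fun i _ => h0 i) (fun i _ => k0 i).
move=> /(congr1 fine); rewrite !fineB ?fE ?esum_fin//.
Qed.

Lemma rsum_ge0E h : (forall i, 0 <= h i) -> abs_summable h ->
  (rsum h)%:E = (\esum_(i in [set: I]) (h i)%:E)%E.
Proof.
move=> h0 sh; have z0 : abs_summable (fun=> 0 : R).
  apply: abs_summable_le sh => i; by rewrite normr0.
have := rsumB sh z0 h0 (fun=> lexx _).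
rewrite [X in _ - fine X]esum1// subr0 => e.
rewrite -[RHS]fineK ?esum_fin// -e.
by congr (rsum _)%:E; apply/funext => i; rewrite subr0.
Qed.

(** A nonnegative family is summable, with sum at most M, as soon as M bounds its
    finite partial sums: this lemma and [rsum_le]. Most estimates below only use
    this and the converse [sum_le_rsum]. *)
Lemma abs_summable_bound h M :
  (forall s, uniq s -> \sum_(i <- s) `|h i| <= M) -> abs_summable h.
Proof.
move=> hM; apply: (@le_lt_trans _ _ M%:E); last by rewrite ltry.
apply: ge_ereal_sup => _ /= [X [finX _] <-].
rewrite fsbig_finite//= (eq_bigr (fun i => `|h i|%:E)); last first.
  by [].
by rewrite sumEFin lee_fin hM.
Qed.

Lemma rsum_le h M : (forall i, 0 <= h i) ->
  (forall s, uniq s -> \sum_(i <- s) h i <= M) -> rsum h <= M.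
Proof.
move=> h0 hM; have sh : abs_summable h.
  apply: (@abs_summable_bound h M) => s us.
  by under eq_bigr do rewrite ger0_norm//; exact: hM.
rewrite -lee_fin rsum_ge0E//; apply: ge_ereal_sup => _ /= [X [finX _] <-].
by rewrite fsbig_finite//= sumEFin lee_fin hM.
Qed.

Lemma sum_le_rsum h s : (forall i, 0 <= h i) -> abs_summable h ->
  uniq s -> \sum_(i <- s) h i <= rsum h.
Proof.
move=> h0 sh us; rewrite -lee_fin rsum_ge0E//; apply: esum_ge.
exists [set` s]; first by split.
by rewrite -(fsbig_seq _ _ us) sumEFin.
Qed.

Lemma term_le_rsum h i : (forall i, 0 <= h i) -> abs_summable h ->
  h i <= rsum h.
Proof. by move=> h0 sh; rewrite (le_trans _ (@sum_le_rsum h [:: i] _ _ _))// big_seq1. Qed.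

Lemma rsum_ge0 h : (forall i, 0 <= h i) -> abs_summable h -> 0 <= rsum h.
Proof. by move=> h0 sh; have := @sum_le_rsum h [::] h0 sh isT; rewrite big_nil. Qed.

Lemma abs_summableZ c h : abs_summable h -> abs_summable (fun i => c * h i).
Proof.
move=> sh; have sn : abs_summable (fun i => `|h i|).
  by apply: abs_summable_le sh => i; rewrite normr_id.
apply: (@abs_summable_bound _ (`|c| * rsum (fun i => `|h i|))) => s us.
under eq_bigr do rewrite normrM.
by rewrite -mulr_sumr ler_wpM2l// sum_le_rsum.
Qed.

Let pos h i := Num.max (h i) 0.
Let neg h i := Num.max (- h i) 0.

Let pos_ge0 h i : 0 <= pos h i. Proof. by rewrite le_max lexx orbT. Qed.
Let neg_ge0 h i : 0 <= neg h i. Proof. by rewrite le_max lexx orbT. Qed.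

Let pos_summable h : abs_summable h -> abs_summable (pos h).
Proof.
apply: abs_summable_le => i; rewrite ger0_norm ?pos_ge0//.
by rewrite ge_max normr_ge0 ler_norm.
Qed.

Let neg_summable h : abs_summable h -> abs_summable (neg h).
Proof.
move=> sh; apply: (@pos_summable (fun i => - h i)).
by apply: abs_summable_le sh => i; rewrite normrN.
Qed.

Let posneg h i : h i = pos h i - neg h i.
Proof. by rewrite /pos /neg; rewrite !maxEle; case: ifP => a; case: ifP => b; lra. Qed.

(** A difference of nonnegative families may be used in place of the
    positive and negative parts; linearity reduces to this. *)
Let rsum_sub h k : abs_summable h -> abs_summable k ->
  (forall i, 0 <= h i) -> (forall i, 0 <= k i) ->
  rsum (fun i => h i - k i) = rsum h - rsum k.
Proof.
by move=> sh sk h0 k0; rewrite rsumB// -(rsum_ge0E h0 sh) -(rsum_ge0E k0 sk).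
Qed.

Let rsum_posneg h : abs_summable h -> rsum h = rsum (pos h) - rsum (neg h).
Proof.
move=> sh; have [hp hn] := (pos_summable sh, neg_summable sh).
by rewrite -rsum_sub//; congr rsum; apply/funext => i; exact: posneg.
Qed.

Let rsumD_ge0 h k : abs_summable h -> abs_summable k ->
  (forall i, 0 <= h i) -> (forall i, 0 <= k i) ->
  rsum (fun i => h i + k i) = rsum h + rsum k.
Proof.
move=> sh sk h0 k0; apply: (@congr1 _ _ fine _%:E ((rsum h)%:E + (rsum k)%:E)%E).
rewrite (rsum_ge0E h0 sh) (rsum_ge0E k0 sk) -esumD => [|i _|i _]; rewrite ?lee_fin//.
rewrite rsum_ge0E//; last exact: abs_summableD.
by move=> i; exact: addr_ge0.
Qed.

Lemma rsumD h k : abs_summable h -> abs_summable k ->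
  rsum (fun i => h i + k i) = rsum h + rsum k.
Proof.
move=> sh sk.
have -> : (fun i => h i + k i) =
    (fun i => (pos h i + pos k i) - (neg h i + neg k i)).
  by apply/funext => i; rewrite (posneg h) (posneg k); ring.
have [hp hn] := (pos_summable sh, neg_summable sh).
have [kp kn] := (pos_summable sk, neg_summable sk).
rewrite rsum_sub ?rsumD_ge0//; do ?exact: abs_summableD;
  try by move=> i; rewrite addr_ge0.
by rewrite (rsum_posneg sh) (rsum_posneg sk); ring.
Qed.

Let rsumZ_ge0 c h : 0 <= c -> abs_summable h -> (forall i, 0 <= h i) ->
  rsum (fun i => c * h i) = c * rsum h.
Proof.
have le_rZ d k : 0 <= d -> abs_summable k -> (forall i, 0 <= k i) ->
    rsum (fun i => d * k i) <= d * rsum k.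
  move=> d0 sk k0; apply: rsum_le => [i|s us]; first by rewrite mulr_ge0.
  by rewrite -mulr_sumr ler_wpM2l// sum_le_rsum.
move=> c0 sh h0; apply/eqP; rewrite eq_le le_rZ//=.
have [->|cN0] := eqVneq c 0.
  by rewrite mul0r; apply: rsum_ge0 => [i|]; [rewrite mul0r|exact: abs_summableZ].
have cp : 0 < c by rewrite lt_def cN0.
(* The reverse inequality is the first one for the factor c^-1 and the
   family c * h. *)
rewrite -ler_pdivlMl//.
have := @le_rZ c^-1 (fun i => c * h i) _ (abs_summableZ c sh) _.
rewrite invr_ge0 => /(_ c0 (fun i => mulr_ge0 c0 (h0 i))).
by under [X in rsum X <= _]eq_fun do rewrite mulKf//.
Qed.

Lemma rsumZ c h : abs_summable h -> rsum (fun i => c * h i) = c * rsum h.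
Proof.
move=> sh; have [hp hn] := (pos_summable sh, neg_summable sh).
have e := rsum_posneg sh.
have [c0|c0] := leP 0 c.
  have -> : (fun i => c * h i) = (fun i => c * pos h i - c * neg h i).
    by apply/funext => i; rewrite -mulrBr -posneg.
  rewrite rsum_sub ?rsumZ_ge0//; do ?exact: abs_summableZ;
    try by move=> i; rewrite mulr_ge0.
  by rewrite e; ring.
have {}c0 : 0 <= - c by rewrite oppr_ge0 ltW.
have -> : (fun i => c * h i) = (fun i => (- c) * neg h i - (- c) * pos h i).
  by apply/funext => i; rewrite [in LHS](posneg h i); ring.
rewrite rsum_sub ?rsumZ_ge0//; do ?exact: abs_summableZ;
  try by move=> i; rewrite mulr_ge0.
by rewrite e; ring.
Qed.

End RealSums.

Section ComplexSums.
Context {R : realType} {I : choiceType}.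
Local Notation C := R[i].
Implicit Types (z w : C) (h k : I -> C).

(** The squared modulus, as a real number and a polynomial in the real and
    imaginary parts. *)
Definition sqn z : R := Re z ^+ 2 + Im z ^+ 2.

Lemma sqn_ge0 z : 0 <= sqn z.
Proof. by rewrite addr_ge0 ?sqr_ge0. Qed.

Lemma sqnE z : (sqn z)%:C = `|z| ^+ 2.
Proof. exact: add_Re2_Im2. Qed.

Lemma sqn_eq0 z : sqn z = 0 -> z = 0.
Proof.
by move=> z0; apply/eqP; rewrite -normr_eq0 -sqrf_eq0 -sqnE z0.
Qed.

Lemma sqn0 : sqn 0 = 0. Proof. by rewrite /sqn !expr0n addr0. Qed.

Lemma sqnM z w : sqn (z * w) = sqn z * sqn w.
Proof. by case: z w => a b [c d]; rewrite /sqn /=; ring. Qed.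

Lemma sqn_normD z w : sqn (z + w) <= 2 * sqn z + 2 * sqn w.
Proof.
case: z w => a b [c d]; rewrite /sqn /= -subr_ge0.
rewrite [X in 0 <= X](_ : _ = (a - c) ^+ 2 + (b - d) ^+ 2); last by ring.
by rewrite addr_ge0 ?sqr_ge0.
Qed.

Lemma ReD z w : Re (z + w) = Re z + Re w.
Proof. by case: z w => a b []. Qed.

Lemma ReB z w : Re (z - w) = Re z - Re w.
Proof. by case: z w => a b []. Qed.

Lemma ImB z w : Im (z - w) = Im z - Im w.
Proof. by case: z w => a b []. Qed.

Lemma conjE z : z^* = Complex (Re z) (- Im z).
Proof. by case: z. Qed.

(** Inner products of square-summable families converge absolutely because
    of this bound and the next one; the constants are not sharp. *)
Lemma Re_conjM_le z w : `|Re (z^* * w)| <= sqn z + sqn w.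
Proof.
case: z w => a b [c d]; rewrite conjE /sqn /= ler_norml.
rewrite -subr_ge0 -[X in _ && X]subr_ge0.
rewrite [X in (0 <= X) && _](_ : _ =
  (a + c / 2) ^+ 2 + (b + d / 2) ^+ 2 + (c ^+ 2 + d ^+ 2) * (3 / 4)); last by field.
rewrite [X in _ && (0 <= X)](_ : _ =
  (a - c / 2) ^+ 2 + (b - d / 2) ^+ 2 + (c ^+ 2 + d ^+ 2) * (3 / 4)); last by field.
by apply/andP; split; rewrite addr_ge0 ?mulr_ge0 ?addr_ge0 ?sqr_ge0//; lra.
Qed.

Lemma Im_conjM_le z w : `|Im (z^* * w)| <= sqn z + sqn w.
Proof.
have -> : Im (z^* * w) = Re (z^* * (Complex (Im w) (- Re w))).
  by rewrite !conjE; case: z w => a b [c d] /=; ring.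
apply: le_trans (Re_conjM_le _ _) _.
by rewrite /sqn /= sqrrN [X in _ + X]addrC.
Qed.

Definition c_summable h :=
  abs_summable (fun i => Re (h i)) && abs_summable (fun i => Im (h i)).

Definition csum h : C :=
  Complex (rsum (fun i => Re (h i))) (rsum (fun i => Im (h i))).

Lemma csumD h k : c_summable h -> c_summable k ->
  csum (fun i => h i + k i) = csum h + csum k.
Proof.
move=> /andP[h1 h2] /andP[k1 k2]; rewrite /csum.
have e : (fun i => Re (h i + k i)) = (fun i => Re (h i) + Re (k i)).
  by apply/funext => i; case: (h i) (k i) => ? ? [].
have e' : (fun i => Im (h i + k i)) = (fun i => Im (h i) + Im (k i)).
  by apply/funext => i; case: (h i) (k i) => ? ? [].
by rewrite e e' !rsumD.
Qed.

Lemma csumZ c h : c_summable h -> csum (fun i => c * h i) = c * csum h.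
Proof.
case: c => a b /andP[h1 h2]; rewrite /csum.
have e : (fun i => Re (Complex a b * h i)) =
    (fun i => a * Re (h i) + (- b) * Im (h i)).
  by apply/funext => i; case: (h i) => c d /=; ring.
have e' : (fun i => Im (Complex a b * h i)) =
    (fun i => a * Im (h i) + b * Re (h i)).
  by apply/funext => i; case: (h i) => c d /=; ring.
rewrite e e' !rsumD ?rsumZ//; do ?exact: abs_summableZ.
by apply/eqP; rewrite eq_complex /=; apply/andP; split; apply/eqP; ring.
Qed.

Lemma csum_conj h : c_summable h -> csum (fun i => (h i)^*) = (csum h)^*.
Proof.
move=> /andP[h1 h2]; rewrite [RHS]conjE /csum /= -mulN1r -rsumZ//.
congr Complex; congr rsum; apply/funext => i; rewrite conjE //=; ring.
Qed.

Definition sq_summable : {pred I -> C} :=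
  fun f => abs_summable (fun i => sqn (f i)).

Fact sq_summable_closed : submod_closed sq_summable.
Proof.
split=> [|c f g]; rewrite !unfold_in.
  apply: (@abs_summable_bound _ _ _ 0) => s _.
  by rewrite big1// => i _; rewrite [(0 : I -> C) i]/(0 : C) sqn0 normr0.
move=> sf sg.
apply: abs_summable_le (abs_summableD (abs_summableZ (2 * sqn c) sf)
  (abs_summableZ 2 sg)) => i.
have c0 : 0 <= 2 * sqn c * sqn (f i) by rewrite !mulr_ge0 ?sqn_ge0.
have g0 : 0 <= 2 * sqn (g i) by rewrite mulr_ge0 ?sqn_ge0.
rewrite ger0_norm ?sqn_ge0// ger0_norm ?addr_ge0//.
by rewrite (le_trans (sqn_normD _ _))// lerD2r -mulrA -sqnM.
Qed.

HB.instance Definition _ :=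
  GRing.isSubmodClosed.Build C (I -> C) sq_summable sq_summable_closed.

End ComplexSums.

(** * The Hilbert space of square-summable functions *)

(** The space l^2(I). *)
Record ell2 (R : realType) (I : choiceType) :=
  Ell2 { ell2_fun :> I -> R[i]; ell2P : ell2_fun \in sq_summable }.

Section Ell2.
Variables (R : realType) (I : choiceType).
Local Notation C := R[i].
Local Notation ell2 := (ell2 R I).
Implicit Types (f g : ell2).

HB.instance Definition _ := [isSub for @ell2_fun R I].
HB.instance Definition _ := [Choice of ell2 by <:].
HB.instance Definition _ := [SubChoice_isSubLmodule of ell2 by <:].

Lemma ell2_ext f g : (forall i, f i = g i) -> f = g.
Proof. by move=> fg; apply/val_inj/funext. Qed.

Lemma ell2_summable f : abs_summable (fun i => sqn (f i)).
Proof. exact: ell2P. Qed.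

Definition ell2_dot f g : C := csum (fun i => (f i)^* * g i).

Lemma dot_summable f g : c_summable (fun i => (f i)^* * g i).
Proof.
have s := abs_summableD (ell2_summable f) (ell2_summable g).
apply/andP; split; apply: abs_summable_le s => i;
  rewrite [leRHS](ger0_norm (addr_ge0 (sqn_ge0 _) (sqn_ge0 _))).
- exact: Re_conjM_le.
- exact: Im_conjM_le.
Qed.

Lemma ell2_dotD f g h : ell2_dot f (g + h) = ell2_dot f g + ell2_dot f h.
Proof.
rewrite /ell2_dot -csumD; [|exact: dot_summable..].
by congr csum; apply/funext => i; rewrite -mulrDr.
Qed.

Lemma ell2_dotZ c f g : ell2_dot f (c *: g) = c * ell2_dot f g.
Proof.
rewrite /ell2_dot -csumZ; last exact: dot_summable.
by congr csum; apply/funext => i; rewrite mulrCA.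
Qed.

Lemma ell2_dotC f g : ell2_dot g f = (ell2_dot f g)^*.
Proof.
rewrite /ell2_dot -csum_conj; last exact: dot_summable.
by congr csum; apply/funext => i; rewrite rmorphM /= conjCK mulrC.
Qed.

Lemma ell2_dotE f : ell2_dot f f = (rsum (fun i => sqn (f i)))%:C.
Proof.
rewrite /ell2_dot /csum; have -> : (fun i => Im ((f i)^* * f i)) = fun=> 0 * 0.
  by apply/funext => i; rewrite conjE; case: (f i) => a b /=; ring.
rewrite rsumZ ?mul0r; last first.
  by apply: (@abs_summable_bound _ _ _ 0) => s _; rewrite big1// => i _; exact: normr0.
congr Complex; congr rsum; apply/funext => i.
by rewrite conjE; case: (f i) => a b /=; rewrite /sqn /=; ring.
Qed.

Lemma ell2_dot_ge0 f : 0 <= ell2_dot f f.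
Proof.
rewrite ell2_dotE ler0c rsum_ge0//; last exact: ell2_summable.
by move=> i; exact: sqn_ge0.
Qed.

Lemma ell2_dot_eq0 f : ell2_dot f f = 0 -> f = 0.
Proof.
rewrite ell2_dotE => /complexI f0; apply: ell2_ext => i.
apply/sqn_eq0/eqP; rewrite eq_le sqn_ge0 -f0 andbT.
apply: (@term_le_rsum _ _ (fun i => sqn (f i))) => [j|].
  exact: sqn_ge0.
exact: ell2_summable.
Qed.

Definition ell2_norm f : C := sqrtC (ell2_dot f f).

Lemma ell2_normD f g : ell2_norm (f + g) <= ell2_norm f + ell2_norm g.
Proof.
exact: (form_triangle ell2_dotD ell2_dotZ ell2_dotC ell2_dot_ge0 ell2_dot_eq0).
Qed.

Lemma ell2_normZ c f : ell2_norm (c *: f) = `|c| * ell2_norm f.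
Proof.
rewrite /ell2_norm ell2_dotZ (formZl ell2_dotZ ell2_dotC) mulrA -normCK.
by rewrite rootCMl ?exprn_ge0// sqrCK.
Qed.

Lemma ell2_norm_eq0 f : ell2_norm f = 0 -> f = 0.
Proof. by move=> /eqP; rewrite sqrtC_eq0 => /eqP/ell2_dot_eq0. Qed.

HB.instance Definition _ := Lmodule_isNormed.Build C ell2
  ell2_normD ell2_normZ ell2_norm_eq0.

Lemma ell2_normE f : `|f| ^+ 2 = (rsum (fun i => sqn (f i)))%:C.
Proof. by rewrite -ell2_dotE -[LHS]/(ell2_norm f ^+ 2) sqrtCK. Qed.

End Ell2.

Section Ell2Complete.
Variables (R : realType) (I : choiceType).
Local Notation C := R[i].
Local Notation ell2 := (ell2 R I).

Lemma real_of_pos (e : C) : 0 < e -> exists2 r : R, 0 < r & e = r%:C.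
Proof.
by rewrite ltcE => /andP[/eqP /= e0 er]; exists (Re e) => //; case: e e0 er => a b /= ->.
Qed.

Lemma ell2_dist_lt (f g : ell2) (r : R) : 0 < r ->
  `|f - g| < r%:C -> rsum (fun i => sqn (f i - g i)) < r ^+ 2.
Proof.
move=> r0 fg; rewrite -ltcR rmorphXn /= -(ell2_normE (f - g)).
by rewrite ltr_pXn2r// nnegrE ?normr_ge0// ler0c ltW.
Qed.

(** A Cauchy filter converges pointwise, because a coordinate is at most the
    norm. The bound on a distance to the limit passes to finite partial
    sums, hence to the whole sum. *)
Lemma ell2_complete (F : set_system ell2) : ProperFilter F -> cauchy F -> cvg F.
Proof.
move=> FF cF.
have Fball (r : R) : 0 < r -> exists f0 : ell2,
    F [set f | rsum (fun i => sqn (f0 i - f i)) < r ^+ 2].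
  move=> r0; have /cauchyP /(_ r%:C) := cF.
  rewrite ltcR => /(_ r0) [f0 Ff0]; exists f0; apply: filterS Ff0 => f.
  by rewrite -ball_normE; exact: ell2_dist_lt.
have term_lt (f g : ell2) r i : 0 < r -> rsum (fun i => sqn (f i - g i)) < r ^+ 2 ->
    sqn (f i - g i) < r ^+ 2.
  move=> r0; apply: le_lt_trans.
  apply: (@term_le_rsum _ _ (fun i => sqn (f i - g i))) => [j|]; first exact: sqn_ge0.
  exact: (ell2_summable (f - g)).
have cR i : cvg ((fun f : ell2 => Re (f i)) @ F).
  apply/cauchy_cvgP/cauchyP => e e0; have [f0 Ff0] := Fball e e0.
  exists (Re (f0 i)).
  change (F [set f : ell2 | `|Re (f0 i) - Re (f i)| < e]).
  apply: filterS Ff0 => f /(term_lt _ _ _ i e0)/(le_lt_trans _) h /=.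
  rewrite -ltr_sqr ?nnegrE// ?ltW//.
  rewrite real_normK ?num_real//; apply: h.
  by rewrite /sqn ReB lerDl sqr_ge0.
have cI i : cvg ((fun f : ell2 => Im (f i)) @ F).
  apply/cauchy_cvgP/cauchyP => e e0; have [f0 Ff0] := Fball e e0.
  exists (Im (f0 i)).
  change (F [set f : ell2 | `|Im (f0 i) - Im (f i)| < e]).
  apply: filterS Ff0 => f /(term_lt _ _ _ i e0)/(le_lt_trans _) h /=.
  rewrite -ltr_sqr ?nnegrE// ?ltW//.
  rewrite real_normK ?num_real//; apply: h.
  by rewrite /sqn ImB lerDr sqr_ge0.
pose l i : C := Complex (lim ((fun f : ell2 => Re (f i)) @ F))
                        (lim ((fun f : ell2 => Im (f i)) @ F)).
(* A partial sum is a continuous function of finitely many coordinates. *)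
have lim_le (f0 : ell2) r s : 0 < r -> uniq s ->
    F [set f | rsum (fun i => sqn (f0 i - f i)) < r ^+ 2] ->
    \sum_(i <- s) sqn (f0 i - l i) <= r ^+ 2.
  move=> r0 us Ff0.
  pose u (f : ell2) := \sum_(i <- s) sqn (f0 i - f i).
  have cq i : sqn (f0 i - (f : ell2) i) @[f --> F] --> sqn (f0 i - l i).
    rewrite /sqn ReB ImB !expr2; under eq_fun do rewrite ReB ImB !expr2.
    have re : Re (f0 i) - Re ((f : ell2) i) @[f --> F] --> Re (f0 i) - Re (l i).
      by apply: cvgB; [exact: cvg_cst | exact: cR].
    have im : Im (f0 i) - Im ((f : ell2) i) @[f --> F] --> Im (f0 i) - Im (l i).
      by apply: cvgB; [exact: cvg_cst | exact: cI].
    by apply: cvgD; apply: cvgM.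
  have cu : u @ F --> \sum_(i <- s) sqn (f0 i - l i).
    rewrite /u; elim: s {us u} => [|i s IHs].
      by under eq_fun do rewrite big_nil; rewrite big_nil; exact: cvg_cst.
    by under eq_fun do rewrite big_cons; rewrite big_cons; exact: (cvgD (cq i) IHs).
  apply: (cvgr_to_le cu).
  apply: filterS Ff0 => f /ltW; apply: le_trans.
  apply: (@sum_le_rsum _ _ (fun i => sqn (f0 i - f i))) => // [j|]; first exact: sqn_ge0.
  exact: (ell2_summable (f0 - f)).
(* The limit is square-summable as the difference of f1 and f1 - l. *)
have sl : l \in @sq_summable R I.
  have [f1 Ff1] := Fball 1 ltr01.
  have s1 : (fun i => f1 i - l i) \in @sq_summable R I.
    apply: (@abs_summable_bound _ _ _ (1 ^+ 2)) => s us.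
    under eq_bigr do rewrite (ger0_norm (sqn_ge0 _)).
    exact: lim_le.
  have -> : l = ell2_fun f1 - (fun i => f1 i - l i).
    by apply/funext => i; rewrite -[RHS]/(f1 i - (f1 i - l i)) subKr.
  by rewrite rpredB// (ell2P f1).
pose L := Ell2 sl.
apply/cvg_ex; exists L; apply/cvgrPdist_lt => e /real_of_pos[r r0 ->].
have r2 : 0 < r / 2 by rewrite divr_gt0.
have [f0 Ff0] := Fball _ r2.
have f0L : `|f0 - L| <= (r / 2)%:C.
  rewrite -(ler_pXn2r (n := 2)) ?nnegrE ?ler0c ?(ltW r2)//.
  rewrite ell2_normE -rmorphXn /= lecR; apply: rsum_le => [i|s us].
    exact: sqn_ge0.
  exact: lim_le.
apply: filterS Ff0 => f f0f; rewrite distrC -(subrKA f0) (le_lt_trans (ler_normD _ _))//.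
rewrite [r]splitr rmorphD /= ltr_leD// distrC.
rewrite -(ltr_pXn2r (n := 2)) ?nnegrE ?ler0c ?(ltW r2)//.
by rewrite (ell2_normE (f0 - f)) -rmorphXn /= ltcR.
Qed.

HB.instance Definition _ := Uniform_isComplete.Build ell2 ell2_complete.

Lemma ell2_dot_norm (f : ell2) : ell2_dot f f = `|f| ^+ 2.
Proof. by rewrite ell2_normE ell2_dotE. Qed.

HB.instance Definition _ := isHilbert.Build R ell2
  (@ell2_dotD R I) (@ell2_dotZ R I) (@ell2_dotC R I) ell2_dot_norm.

End Ell2Complete.

(** * Norms as real numbers *)

Section RealNorm.
Context {R : realType}.
Local Notation C := R[i].

Lemma conj_real (r : R) : (r%:C : C)^* = r%:C.
Proof. by rewrite conjE /= oppr0. Qed.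

(** Norms of complex normed spaces take their values in R[i], while C*-norms
    take theirs in R; estimates that mix them are done in R. *)
Definition rnorm (V : normedZmodType C) (u : V) : R := Re `|u|.

Lemma rnormE (V : normedZmodType C) (u : V) : `|u| = (rnorm u)%:C.
Proof. by rewrite /rnorm RRe_real// normr_real. Qed.

Lemma rnorm_ge0 (V : normedZmodType C) (u : V) : 0 <= rnorm u.
Proof. by rewrite -ler0c -rnormE. Qed.

Lemma Re_le_rnorm (z : C) : Re z <= rnorm z.
Proof. by rewrite (le_trans (ler_norm _))// -lecR -rnormE normc_ge_Re. Qed.

Lemma rnorm0 (V : normedZmodType C) : rnorm (0 : V) = 0.
Proof. by rewrite /rnorm normr0. Qed.

Lemma rnorm_eq0 (V : normedZmodType C) (u : V) : rnorm u = 0 -> u = 0.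
Proof. by move=> u0; apply/normr0_eq0; rewrite rnormE u0. Qed.

Lemma rnormN (V : normedZmodType C) (u : V) : rnorm (- u) = rnorm u.
Proof. by rewrite /rnorm normrN. Qed.

Lemma rnormD (V : normedZmodType C) (u v : V) : rnorm (u + v) <= rnorm u + rnorm v.
Proof. by rewrite -lecR rmorphD /= -!rnormE ler_normD. Qed.

Lemma rnormB (V : normedZmodType C) (u v w : V) :
  rnorm (u - v) <= rnorm (u - w) + rnorm (w - v).
Proof. by rewrite -(subrKA w) rnormD. Qed.

Lemma rnorm_distC (V : normedZmodType C) (u v : V) : rnorm (u - v) = rnorm (v - u).
Proof. by rewrite -rnormN opprB. Qed.

Lemma rnormZ (V : normedModType C) c (u : V) : rnorm (c *: u) = rnorm c * rnorm u.
Proof. by apply: complexI; rewrite rmorphM /= -!rnormE normrZ. Qed.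

Lemma rnorm_real (r : R) : 0 <= r -> rnorm (r%:C : C) = r.
Proof. by move=> r0; rewrite /rnorm ger0_norm// ler0c. Qed.

Lemma rnorm_sum (V : normedZmodType C) (J : finType) (F : J -> V) :
  rnorm (\sum_j F j) <= \sum_j rnorm (F j).
Proof.
elim/big_ind2: _ => [|a x b y ax by_|//]; first by rewrite rnorm0.
exact: le_trans (rnormD _ _) (lerD ax by_).
Qed.

(** The standard end of an estimate up to an arbitrary error e, where K
    collects the constants. *)
Lemma le_of_small (a b K : R) : (forall e, 0 < e -> a <= b + e * K) -> a <= b.
Proof.
move=> aK; rewrite leNgt; apply/negP => ba.
have K0 : 0 < K by have := aK 1 ltr01; lra.
have := aK ((a - b) / (2 * K)); rewrite divr_gt0 ?mulr_gt0 ?subr_gt0// => /(_ isT).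
rewrite invfM mulrA mulfVK ?gt_eqF//; lra.
Qed.

Lemma rnorm_small (V : normedZmodType C) (u : V) (K : R) :
  (forall e, 0 < e -> rnorm u <= e * K) -> u = 0.
Proof.
move=> uK; apply/rnorm_eq0/eqP; rewrite eq_le rnorm_ge0 andbT.
by apply: (@le_of_small _ _ K) => e e0; rewrite add0r uK.
Qed.

Lemma le_scale_limit (m p q : R) : 0 <= q ->
  (forall c, m < c -> p <= c * q) -> p <= m * q.
Proof.
move=> q0 h; apply/ler_addgt0Pr => e e0.
have q1 : 0 < q + 1 by rewrite ltr_wpDl.
have := h (m + e / (q + 1)); rewrite ltrDl divr_gt0// => /(_ isT)/le_trans; apply.
rewrite mulrDl lerD2l mulrAC ler_pdivrMr// ler_pM2l//; lra.
Qed.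

(** The sequential form of completeness, which is the one stated for
    C*-algebras. *)
Lemma complete_seq (V : completeNormedModType C) (u : nat -> V) :
  (forall e : R, 0 < e -> exists N, forall m n : nat,
     (N <= m)%N -> (N <= n)%N -> rnorm (u m - u n) < e) ->
  exists l, forall e : R, 0 < e -> exists N, forall n : nat,
     (N <= n)%N -> rnorm (u n - l) < e.
Proof.
move=> cu.
have : cvg (u @ \oo).
  apply/cauchy_cvgP/cauchyP => e /real_of_pos[r r0 ->].
  have [N uN] := cu r r0; exists (u N).
  exists N => // n /= Nn; rewrite -ball_normE /= rnormE ltcR; exact: uN.
move=> /cvg_ex[l ul]; exists l => e e0.
have /cvgrPdist_lt/(_ e%:C) := ul; rewrite ltcR => /(_ e0)[N _ uN].
by exists N => n Nn; rewrite rnorm_distC -ltcR -rnormE; exact: uN.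
Qed.

End RealNorm.

Section HilbertFacts.
Context {R : realType}.
Variable H : hilbertType R.
Implicit Types u v w : H.

Lemma dot_rnorm u : dot u u = (rnorm u ^+ 2)%:C.
Proof. by rewrite dot_norm rnormE rmorphXn. Qed.

Lemma dot_ge0 u : 0 <= dot u u.
Proof. by rewrite dot_norm exprn_ge0. Qed.

Lemma dot_eq0 u : dot u u = 0 -> u = 0.
Proof. by move=> /eqP; rewrite dot_norm sqrf_eq0 normr_eq0 => /eqP. Qed.

Lemma dot0r u : dot u 0 = 0. Proof. exact: (form0r dotZr). Qed.

Lemma dotDl u v w : dot (u + v) w = dot u w + dot v w.
Proof. exact: (formDl dotDr dotC). Qed.

Lemma dotZl c u v : dot (c *: u) v = c^* * dot u v.
Proof. exact: (formZl dotZr dotC). Qed.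

Lemma dotNr u v : dot u (- v) = - dot u v.
Proof. exact: (formNr dotZr). Qed.

Lemma dotNl u v : dot (- u) v = - dot u v.
Proof. exact: (formNl dotZr dotC). Qed.

Lemma dot_CauchySchwarz u v : rnorm (dot u v) <= rnorm u * rnorm v.
Proof.
rewrite -lecR rmorphM /= -!rnormE -(ler_pXn2r (n := 2)) ?nnegrE ?mulr_ge0//.
rewrite exprMn -!dot_norm.
exact: (form_CauchySchwarz dotDr dotZr dotC dot_ge0 dot_eq0).
Qed.

End HilbertFacts.

(** * Square roots in C*-algebras and contractivity of representations *)

Section CStarFacts.
Context {R : realType} {A : cstarAlgType R}.
Local Notation C := R[i].
Implicit Types x y h w : A.

Lemma cnorm0 : cnorm (0 : A) = 0.
Proof. by rewrite -(scale0r 0) cnormZ normr0 mul0r. Qed.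

Lemma cnormN x : cnorm (- x) = cnorm x.
Proof. by rewrite -scaleN1r cnormZ normrN1 mul1r. Qed.

Lemma cnorm_ge0 x : 0 <= cnorm x.
Proof.
have := cnormD x (- x); rewrite subrr cnorm0 cnormN; lra.
Qed.

Lemma cnorm_distC x y : cnorm (x - y) = cnorm (y - x).
Proof. by rewrite -cnormN opprB. Qed.

Lemma cnormB x y w : cnorm (x - y) <= cnorm (x - w) + cnorm (w - y).
Proof. by rewrite -(subrKA w) cnormD. Qed.

Lemma star0 : star (0 : A) = 0.
Proof. by rewrite -[in LHS](scale0r 0) starZ conjC0 scale0r. Qed.

Lemma starN x : star (- x) = - star x.
Proof. by rewrite -scaleN1r starZ rmorphN1 scaleN1r. Qed.

Lemma star1 : star (1 : A) = 1.
Proof. by have := starM (1 : A) (star 1); rewrite mul1r starK mul1r => <-. Qed.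

Lemma cnorm_starE x : cnorm (star x) = cnorm x.
Proof.
have le_star y : cnorm y <= cnorm (star y).
  have [y0|yN0] := eqVneq (cnorm y) 0; first by rewrite y0 cnorm_ge0.
  have y_gt0 : 0 < cnorm y by rewrite lt_def yN0 cnorm_ge0.
  by have := cnormM (star y) y; rewrite cnorm_star expr2 ler_pM2r.
by apply/eqP; rewrite eq_le le_star andbT -[in leRHS](starK x) le_star.
Qed.

Lemma subr_square (a b : A) : a * a - b * b = a * (a - b) + (a - b) * b.
Proof. by rewrite mulrBr mulrBl addrA subrK. Qed.

(** An iteration whose fixed points y satisfy (1 - y)^2 = 1 - h. It needs no
    functional calculus, and it stays in any subalgebra that contains h. *)
Fixpoint sqrt_iter h k : A :=
  if k is k'.+1 then (2^-1 : C) *: (h + sqrt_iter h k' * sqrt_iter h k') else 0.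

Lemma rnorm_half : rnorm (2^-1 : C) = 2^-1.
Proof.
rewrite -[in LHS](rmorph_nat (real_complex R)) -fmorphV /=.
by rewrite rnorm_real// invr_ge0.
Qed.

Section Iter.
Variable h : A.
Hypothesis h1 : cnorm h < 1.
Local Notation y := (sqrt_iter h).
Local Notation r := (cnorm h).

Lemma sqrt_iter_le k : cnorm (y k) <= r.
Proof.
elim: k => [|k IH] /=; first by rewrite cnorm0 cnorm_ge0.
rewrite cnormZ -/(rnorm _) rnorm_half.
have := le_trans (cnormD h (y k * y k)) (lerD (lexx _) (cnormM (y k) (y k))).
have : cnorm (y k) * cnorm (y k) <= r * 1.
  by rewrite ler_pM ?cnorm_ge0// (le_trans IH)// ltW.
lra.
Qed.

(** On the ball of radius |h| < 1 the map y |-> (h + y^2) / 2 is Lipschitz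
    with constant |h|. *)
Lemma sqrt_iter_contract m n : cnorm (y (m + n)%N - y n) <= r ^+ n.
Proof.
elim: n => [|n IH]; first by rewrite addn0 subr0 expr0 (le_trans (sqrt_iter_le _))// ltW.
rewrite addnS /= -scalerBr [h + _]addrC addrKA cnormZ -/(rnorm _) rnorm_half.
set a := y (m + n); set b := y n.
rewrite subr_square.
have := cnormD (a * (a - b)) ((a - b) * b).
have : cnorm (a * (a - b)) <= r ^+ n.+1.
  by rewrite exprS (le_trans (cnormM _ _))// ler_pM ?cnorm_ge0// sqrt_iter_le.
have : cnorm ((a - b) * b) <= r ^+ n.+1.
  by rewrite exprSr (le_trans (cnormM _ _))// ler_pM ?cnorm_ge0// sqrt_iter_le.
lra.
Qed.

(** The defect is twice the last step of the iteration. *)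
Lemma sqrt_iter_defect k :
  cnorm ((1 - y k) * (1 - y k) - (1 - h)) <= 2 * r ^+ k.
Proof.
have -> : (1 - y k) * (1 - y k) - (1 - h) = (2 : C) *: (y k.+1 - y k).
  rewrite scalerBr /= scalerA mulfV ?pnatr_eq0// scale1r scaler_nat mulr2n.
  rewrite mulrBl mul1r mulrBr mulr1 !opprB addrC -!addrA addKr opprD.
  by congr (_ + _); rewrite addrCA.
rewrite cnormZ -/(rnorm _) -[2](rmorph_nat (real_complex R)) rnorm_real//.
by rewrite ler_pM2l// (sqrt_iter_contract 1).
Qed.

Lemma pow_small e : 0 < e -> exists N, r ^+ N < e.
Proof.
move=> e0; have : (GRing.exp r : nat -> R) @ \oo --> (0 : R).
  by apply: cvg_expr; rewrite ger0_norm ?cnorm_ge0.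
move=> /cvgrPdist_lt/(_ e e0)[N _ /(_ N (leqnn N))].
by rewrite sub0r normrN ger0_norm ?exprn_ge0 ?cnorm_ge0//; exists N.
Qed.

End Iter.
End CStarFacts.

Section SquareRoots.
Context {R : realType} {A : cstarAlgType R}.
Local Notation C := R[i].
Implicit Types x y h w : A.

Lemma cnorm_small x (K : R) :
  (forall e, 0 < e -> cnorm x <= e * K) -> x = 0.
Proof.
move=> xK; apply/cnorm_eq0/eqP; rewrite eq_le cnorm_ge0 andbT.
by apply: (@le_of_small R _ _ K) => e e0; rewrite add0r xK.
Qed.

Lemma starB x y : star (x - y) = star x - star y.
Proof. by rewrite starD starN. Qed.

Lemma sqrt_iter_star h k : star h = h -> star (sqrt_iter h k) = sqrt_iter h k.
Proof.
move=> hh; elim: k => [|k IH] /=; first exact: star0.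
rewrite starZ starD starM IH hh fmorphV rmorph_nat.
by [].
Qed.

(** The iteration is a contraction, so it converges, and its limit y gives the
    root 1 - y. *)
Lemma self_adjoint_sqrt h : star h = h -> cnorm h < 1 ->
  exists2 w, star w = w & w * w = 1 - h.
Proof.
move=> hh h1; set r := cnorm h; pose y := sqrt_iter h.
have [l yl] : exists l : A, forall e, 0 < e -> exists N, forall n,
    (N <= n)%N -> cnorm (y n - l) < e.
  apply: cnorm_complete => e e0; have [N rN] := pow_small h1 e0.
  exists N => m n Nm Nn.
  wlog le_nm : m n Nm Nn / (n <= m)%N => [th|].
    have [?|/ltnW ?] := leqP n m; first exact: th.
    by rewrite cnorm_distC th.
  rewrite -(subnK le_nm); apply: le_lt_trans (sqrt_iter_contract h1 _ _) _.
  apply: le_lt_trans rN.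
  by rewrite ler_wiXn2l ?cnorm_ge0 ?(ltW h1).
exists (1 - l).
  rewrite starB star1; congr (1 - _); apply/eqP; rewrite -subr_eq0; apply/eqP.
  apply: (@cnorm_small _ 2) => e e0; have [N /(_ N (leqnn N)) yN] := yl e e0.
  apply: le_trans (cnormB _ _ (y N)) _.
  rewrite -[X in star l - X](sqrt_iter_star N hh) -starB cnorm_starE cnorm_distC.
  by rewrite mulr_natr mulr2n lerD// ltW.
apply/eqP; rewrite -subr_eq0; apply/eqP.
pose K := cnorm (1 - l) + (cnorm (1 : A) + r) + 2.
apply: (@cnorm_small _ K) => e e0.
have [N yN] := yl e e0; have [M rM] := pow_small h1 e0.
pose n := maxn N M.
have yn : cnorm (y n - l) <= e by rewrite ltW// yN// leq_maxl.
have rn : r ^+ n <= e.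
  apply: le_trans (ltW rM).
  by rewrite ler_wiXn2l ?cnorm_ge0 ?(ltW h1)// leq_maxr.
apply: le_trans (cnormB _ _ ((1 - y n) * (1 - y n))) _.
have -> : (1 - l) * (1 - l) - (1 - y n) * (1 - y n) =
    (1 - l) * (y n - l) + (y n - l) * (1 - y n).
  have e1 : y n - l = (1 - l) - (1 - y n) by rewrite opprB [RHS]addrC subrKA.
  by rewrite subr_square -e1.
have hn := sqrt_iter_defect h1 n.
have h2 := cnormM (1 - l) (y n - l); have h3 := cnormM (y n - l) (1 - y n).
have h4 := cnormD ((1 - l) * (y n - l)) ((y n - l) * (1 - y n)).
have h5 := cnormD 1 (- y n); rewrite cnormN in h5.
have h6 := sqrt_iter_le h1 n.
have b2 : cnorm (1 - l) * cnorm (y n - l) <= cnorm (1 - l) * e.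
  by rewrite ler_wpM2l ?cnorm_ge0.
have b3 : cnorm (y n - l) * cnorm (1 - y n) <= e * (cnorm (1 : A) + r).
  by rewrite ler_pM ?cnorm_ge0// (le_trans h5)// lerD2l.
rewrite /K; move: hn; rewrite -/(y n) -/r => hn; lra.
Qed.

(** If c > |x|, then 1 - c^-2 x^* x is the square of a self-adjoint w, and
    |pi(w) u|^2 >= 0 says that |pi(x) u|^2 <= c^2 |u|^2. *)
Lemma rep_contractive (pi : rep A) x u :
  rnorm (pi x u) <= cnorm x * rnorm u.
Proof.
apply: le_scale_limit => [|c xc]; first exact: rnorm_ge0.
have c0 : 0 < c by apply: le_lt_trans xc; exact: cnorm_ge0.
pose h : A := ((c ^- 2)%:C : C) *: (star x * x).
have hh : star h = h by rewrite starZ starM starK conj_real.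
have h1 : cnorm h < 1.
  rewrite cnormZ -/(rnorm _) rnorm_real ?invr_ge0 ?exprn_ge0 ?(ltW c0)//.
  rewrite cnorm_star mulrC ltr_pdivrMr ?exprn_gt0// mul1r.
  by rewrite ltr_pXn2r// nnegrE ?cnorm_ge0// ltW.
have [w ww wh] := self_adjoint_sqrt hh h1.
have := dot_ge0 (pi w u).
rewrite -rep_star ww -rep_mul wh.
have -> : pi (1 - h) u = u - (c ^- 2)%:C *: pi (star x * x) u.
  have := @rep_linear _ _ pi (- (c ^- 2)%:C) (star x * x) 1 u.
  by rewrite rep_one scaleNr addrC => ->; rewrite scaleNr addrC.
rewrite dotDl dotNl dotZl rep_mul rep_star !dot_rnorm conj_real.
rewrite -rmorphM -rmorphB ler0c subr_ge0 mulrC ler_pdivrMr ?exprn_gt0//.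
rewrite mulrC -exprMn ler_pXn2r// nnegrE ?rnorm_ge0//.
by rewrite mulr_ge0 ?rnorm_ge0// ltW.
Qed.

End SquareRoots.

(** * Digit sequences and indices of matrix units *)

Section Digits.
Variable c : seq_ge2.

Definition digit_seq := forall i, 'I_(c i).
Implicit Types x y z : digit_seq.

(** The row of M_{c_1} (x) ... (x) M_{c_n} that the first n digits
    designate. The last factor of [tensn] is the least significant one, so
    the index is computed like a number in mixed radix with the first digit
    in the leading place. *)
Fixpoint idx x n : 'I_(dimt c n) :=
  if n is m.+1 then mxtens_index (idx x m, x m) else ord0.

Lemma eq_idx x y n : (forall i, (i < n)%N -> x i = y i) -> idx x n = idx y n.
Proof.
elim: n => [//|n IH] xy /=; rewrite xy// IH// => i lt_in.
by rewrite xy// ltnS ltnW.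
Qed.

Lemma idx_eq x y n : idx x n = idx y n -> forall i, (i < n)%N -> x i = y i.
Proof.
elim: n => [//|n IH] /= /(can_inj (@mxtens_indexK _ _))[/IH xy xyn] i.
by rewrite ltnS leq_eqVlt => /predU1P[->|/xy].
Qed.

Definition digit0 : digit_seq := fun i => Ordinal (ltnW (seq_ge2P c i)).
Definition digit1 : digit_seq := fun i => Ordinal (seq_ge2P c i).

(** A section of [idx]; the digits from the n-th on are filled with 0. *)
Fixpoint digits n : 'I_(dimt c n) -> digit_seq :=
  if n is m.+1 return 'I_(dimt c n) -> digit_seq then
    fun k => dfwith (digits (mxtens_unindex k).1) m (mxtens_unindex k).2
  else fun=> digit0.

Lemma digitsS n (k : 'I_(dimt c n)) (l : 'I_(c n)) :
  @digits n.+1 (mxtens_index (k, l)) = dfwith (digits k) n l.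
Proof.
rewrite -[LHS]/(dfwith (digits (mxtens_unindex (mxtens_index (k, l))).1) n
  (mxtens_unindex (mxtens_index (k, l))).2).
by rewrite mxtens_indexK.
Qed.

Lemma digitsK n (k : 'I_(dimt c n)) : idx (digits k) n = k.
Proof.
elim: n k => [|n IH] k /=; first by apply/val_inj; case: k => -[].
rewrite dfwithin -[RHS]mxtens_unindexK; congr mxtens_index.
rewrite [RHS]surjective_pairing; congr pair.
rewrite -[RHS]IH; apply: eq_idx => i lt_in.
by rewrite dfwithout// gtn_eqF.
Qed.

Definition splice n y x : digit_seq := fun i => if (i < n)%N then y i else x i.

Lemma idx_splice n y x : idx (splice n y x) n = idx y n.
Proof. by apply: eq_idx => i; rewrite /splice => ->. Qed.

End Digits.
Arguments idx {c} x n.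
Arguments digits {c n} k.
Arguments digit0 {c}.
Arguments digit1 {c}.

Section TensorOfUnits.
Context {R : realType} (c : seq_ge2).
Local Notation C := R[i].

(** Elementary tensors of matrix units are exactly the matrix units of the
    tensor product; this makes the rule for phi available for all of them. *)
Lemma tensn_delta (x y : digit_seq c) n :
  @tensn R c (fun i => delta_mx (x i) (y i)) n = delta_mx (idx x n) (idx y n).
Proof.
elim: n => [|n IH] /=; apply/matrixP => i j; first by rewrite !mxE !ord1.
rewrite IH; case: (mxtens_indexP i) => i1 i2; case: (mxtens_indexP j) => j1 j2.
rewrite tensmxE !mxE !(can_eq (@mxtens_indexK _ _)) !xpair_eqE.
by rewrite -natrM mulnb andbACA.
Qed.

End TensorOfUnits.

(** The index set of an orthonormal basis on which A(c) acts: what matters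
    is that each index has digits, and that the first n of them can be
    overwritten. The two instances are the tail class of a sequence and the
    product of two index sets. *)
Record indexing (c : seq_ge2) := Indexing {
  index_type :> choiceType;
  dig : index_type -> digit_seq c;
  dig_inj : injective dig;
  upd : nat -> digit_seq c -> index_type -> index_type;
  dig_upd : forall n y x, dig (upd n y x) = splice n y (dig x) }.

Section Indexing.
Context {c : seq_ge2} {I : indexing c}.
Implicit Types (x : I) (y z : digit_seq c).

Lemma upd_same n y x : idx y n = idx (dig x) n -> upd n y x = x.
Proof.
move=> /idx_eq yx; apply: dig_inj; rewrite dig_upd.
by apply: functional_extensionality_dep => i; rewrite /splice; case: ifP => // /yx.
Qed.

Lemma eq_upd n y z x : idx y n = idx z n -> upd n y x = upd n z x.
Proof.
move=> /idx_eq yz; apply: dig_inj; rewrite !dig_upd.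
by apply: functional_extensionality_dep => i; rewrite /splice; case: ifP => // /yz.
Qed.

Lemma upd_upd n y z x : upd n y (upd n z x) = upd n y x.
Proof.
apply: dig_inj; rewrite !dig_upd.
by apply: functional_extensionality_dep => i; rewrite /splice; case: (i < n)%N.
Qed.

Lemma idx_upd n y x : idx (dig (upd n y x)) n = idx y n.
Proof. by rewrite dig_upd idx_splice. Qed.

Lemma upd_succ n y x : y n = dig x n -> upd n.+1 y x = upd n y x.
Proof.
move=> yx; apply: dig_inj; rewrite !dig_upd.
apply: functional_extensionality_dep => i; rewrite /splice ltnS leq_eqVlt.
by case: eqVneq => [->|//]; rewrite ltnn.
Qed.

End Indexing.

Section TailClass.
Variables (c : seq_ge2) (e : digit_seq c).

Definition tail_eq (x : digit_seq c) := exists N, forall i, (N <= i)%N -> x i = e i.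

Definition tail_class := {x : digit_seq c | tail_eq x}.

HB.instance Definition _ := gen_eqMixin tail_class.
HB.instance Definition _ := gen_choiceMixin tail_class.

Definition tail_base : tail_class := exist _ e (ex_intro _ 0%N (fun _ _ => erefl)).

Lemma tail_sval_inj : injective (fun x : tail_class => sval x).
Proof.
move=> [x px] [y py] /= xy; case: _ / xy py => py.
by congr exist; exact: Prop_irrelevance.
Qed.

Fact tail_upd_subproof n y (x : tail_class) : tail_eq (splice n y (sval x)).
Proof.
case: x => x /= [N xN]; exists (maxn N n) => i; rewrite geq_max => /andP[Ni ni].
by rewrite /splice ltnNge ni /= xN.
Qed.

Definition tail_upd n y (x : tail_class) : tail_class :=
  exist _ _ (tail_upd_subproof n y x).

Definition tail_indexing : indexing c :=
  @Indexing c tail_class _ tail_sval_inj tail_upd (fun _ _ _ => erefl).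

End TailClass.

Section ProductIndexing.
Variables (a b : seq_ge2).

(** A digit for a_i b_i is a pair of digits, in the encoding used for phi. *)
Definition join_digits (x : digit_seq a) (y : digit_seq b) : digit_seq (muls a b) :=
  fun i => mxtens_index (x i, y i).
Definition ldigits (z : digit_seq (muls a b)) : digit_seq a :=
  fun i => (mxtens_unindex (z i)).1.
Definition rdigits (z : digit_seq (muls a b)) : digit_seq b :=
  fun i => (mxtens_unindex (z i)).2.

Lemma ldigits_join x y : ldigits (join_digits x y) = x.
Proof. by apply: functional_extensionality_dep => i; rewrite /ldigits mxtens_indexK. Qed.

Lemma rdigits_join x y : rdigits (join_digits x y) = y.
Proof. by apply: functional_extensionality_dep => i; rewrite /rdigits mxtens_indexK. Qed.

Lemma join_lrdigits z : join_digits (ldigits z) (rdigits z) = z.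
Proof.
apply: functional_extensionality_dep => i.
by rewrite /join_digits -surjective_pairing mxtens_unindexK.
Qed.

Lemma idx_join_eq x y x' y' n :
  (idx (join_digits x y) n == idx (join_digits x' y') n) =
  (idx x n == idx x' n) && (idx y n == idx y' n).
Proof.
apply/eqP/andP => [/idx_eq h|[/eqP/idx_eq hx /eqP/idx_eq hy]].
  split; apply/eqP/eq_idx => i /h /(can_inj (@mxtens_indexK _ _))[] //.
by apply: eq_idx => i lt_in; rewrite /join_digits hx// hy.
Qed.

Variables (I : indexing a) (J : indexing b).

Definition prod_dig (p : I * J) := join_digits (dig p.1) (dig p.2).

Lemma prod_dig_inj : injective prod_dig.
Proof.
move=> [x y] [x' y'] /[dup] /(congr1 ldigits) + /(congr1 rdigits).
by rewrite !ldigits_join !rdigits_join => /dig_inj /= -> /dig_inj /= ->.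
Qed.

Definition prod_upd n z (p : I * J) := (upd n (ldigits z) p.1, upd n (rdigits z) p.2).

Lemma prod_dig_upd n z p : prod_dig (prod_upd n z p) = splice n z (prod_dig p).
Proof.
rewrite /prod_dig !dig_upd -[z in RHS]join_lrdigits.
apply: functional_extensionality_dep => i.
by rewrite /join_digits /splice; case: ifP.
Qed.

(** With this index set, the representation of A(a.b) will be the tensor
    product of the representations of A(a) and A(b). *)
Definition prod_indexing : indexing (muls a b) :=
  @Indexing (muls a b) (I * J)%type prod_dig prod_dig_inj prod_upd prod_dig_upd.

End ProductIndexing.

(** * Matrices acting on square-summable functions *)

Section Reindex.
Context {R : realType} {I : choiceType}.
Variables (tau : I -> I) (tau_bij : bijective tau).

Let tau_set_bij : set_bij [set: I] [set: I] tau.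
Proof. by rewrite setTT_bijective. Qed.

Lemma abs_summable_bij (h : I -> R) :
  abs_summable (fun i => h (tau i)) = abs_summable h.
Proof. by rewrite /abs_summable /summable [in RHS](reindex_esum _ _ _ _ tau_set_bij). Qed.

Lemma rsum_bij (h : I -> R) : rsum (fun i => h (tau i)) = rsum h.
Proof.
congr (fine _ - fine _); rewrite [RHS](reindex_esum _ _ _ _ tau_set_bij);
  by apply: eq_esum => i _; rewrite ?funeposE ?funenegE.
Qed.

Lemma csum_bij (h : I -> R[i]) : csum (fun i => h (tau i)) = csum h.
Proof.
by rewrite /csum (rsum_bij (fun i => Re (h i))) (rsum_bij (fun i => Im (h i))).
Qed.

End Reindex.

Section HilbertSums.
Context {R : realType} {H : hilbertType R}.

Lemma dot_sumr (J : finType) (u : H) (F : J -> H) :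
  dot u (\sum_j F j) = \sum_j dot u (F j).
Proof. by apply: (big_morph _ (dotDr u)); exact: dot0r. Qed.

Lemma dot_suml (J : finType) (u : H) (F : J -> H) :
  dot (\sum_j F j) u = \sum_j dot (F j) u.
Proof. by rewrite dotC dot_sumr rmorph_sum /=; apply: eq_bigr => j _; rewrite -dotC. Qed.

End HilbertSums.

Lemma hilbert_tensor_norm (R : realType) (H K L : hilbertType R) (t : H -> K -> L) u v :
  is_hilbert_tensor t -> rnorm (t u v) = rnorm u * rnorm v.
Proof.
move=> [_ _ t_dot _].
apply/eqP; rewrite -(eqrXn2 (n := 2)) ?mulr_ge0 ?rnorm_ge0//; apply/eqP/complexI.
by rewrite -dot_rnorm t_dot !dot_rnorm -rmorphM exprMn.
Qed.

Lemma ell2_sumE (R : realType) (I : choiceType) (J : finType)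
  (F : J -> ell2 R I) x : (\sum_j F j) x = \sum_j F j x.
Proof. exact: (big_morph (fun f : ell2 R I => f x)). Qed.

Lemma sum_mxtens (V : nmodType) m n (F : 'I_(m * n) -> V) :
  \sum_K F K = \sum_k \sum_l F (mxtens_index (k, l)).
Proof.
rewrite pair_bigA (reindex (@mxtens_index m n)) /=.
  by apply: eq_bigr => -[k l] _.
by exists (@mxtens_unindex _ _) => k _; rewrite ?mxtens_indexK ?mxtens_unindexK.
Qed.

Lemma tperm_eqR (T : finType) (j k t : T) : (tperm j k t == k) = (t == j).
Proof. by apply/eqP/eqP => [/(canRL (tpermK j k))|] ->; rewrite ?tpermR ?tpermL. Qed.

Lemma tperm_eqL (T : finType) (j k t : T) : (tperm j k t == j) = (t == k).
Proof. by apply/eqP/eqP => [/(canRL (tpermK j k))|] ->; rewrite ?tpermR ?tpermL. Qed.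

Section MatrixAction.
Context {R : realType} {c : seq_ge2} {I : indexing c}.
Local Notation C := R[i].
Local Notation H := (ell2 R I).
Implicit Types (x : I) (f g : H).

Section Units.
Variables (n : nat) (j k : 'I_(dimt c n)).

(** An involution of the index set that carries the indices in row j to
    those in row k. It reduces matrix units to multiplication by an
    indicator function: this gives square-summability and, by invariance of
    sums under bijections, the adjoint. *)
Definition swap_digits x : I := upd n (digits (tperm j k (idx (dig x) n))) x.

Lemma idx_swap x : idx (dig (swap_digits x)) n = tperm j k (idx (dig x) n).
Proof. by rewrite idx_upd digitsK. Qed.

Lemma swap_digitsK : involutive swap_digits.
Proof.
move=> x; rewrite {1}/swap_digits idx_swap tpermK upd_upd.
by rewrite upd_same// digitsK.
Qed.

Definition restrict_fun f x : C := if idx (dig x) n == k then f x else 0.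

Lemma restrict_sqn f x : sqn (restrict_fun f x) <= sqn (f x).
Proof. by rewrite /restrict_fun; case: ifP => // _; rewrite sqn0 sqn_ge0. Qed.

Lemma restrict_summable f : abs_summable (fun x => sqn (restrict_fun f x)).
Proof.
apply: abs_summable_le (ell2_summable f) => x.
by rewrite !(ger0_norm (sqn_ge0 _)) restrict_sqn.
Qed.

(** On basis vectors this sends the index x, when its first n digits have
    index k, to the index with these digits replaced by those of j, and it
    kills the other basis vectors. *)
Definition mxunit_fun f x : C :=
  if idx (dig x) n == j then f (upd n (digits k) x) else 0.

Lemma mxunit_swap f x : mxunit_fun f x = restrict_fun f (swap_digits x).
Proof.
rewrite /mxunit_fun /restrict_fun idx_swap tperm_eqR; case: eqP => // xj.
by rewrite /swap_digits xj tpermL.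
Qed.

Let swap_bij : bijective swap_digits. Proof. exact: inv_bij swap_digitsK. Qed.

Fact mxunit_summable f : mxunit_fun f \in @sq_summable R I.
Proof.
rewrite unfold_in; under eq_fun do rewrite mxunit_swap.
rewrite (abs_summable_bij swap_bij (fun x => sqn (restrict_fun f x))).
exact: restrict_summable.
Qed.

Definition mxunit f : H := Ell2 (mxunit_summable f).

Lemma mxunit_linear a f g : mxunit (a *: f + g) = a *: mxunit f + mxunit g.
Proof.
apply: ell2_ext => x; rewrite -[RHS]/(a * mxunit_fun f x + mxunit_fun g x) /=.
by rewrite /mxunit_fun; case: ifP => // _; rewrite mulr0 addr0.
Qed.

End Units.

(** The two inner products are sums over the rows k and j; the involution
    exchanges these rows. *)
Lemma mxunit_adjoint n (j k : 'I_(dimt c n)) f g :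
  dot (mxunit k j f) g = dot f (mxunit j k g).
Proof.
have swap_bij : bijective (swap_digits j k) by exact: inv_bij (swap_digitsK j k).
rewrite -[LHS]/(csum _) -[RHS]/(csum _) -[RHS](csum_bij swap_bij).
congr csum; apply/funext => x /=.
rewrite /mxunit_fun idx_swap tperm_eqL; case: eqP => [xk|_]; last first.
  by rewrite conjC0 mul0r mulr0.
rewrite /swap_digits xk tpermR; congr (_ * g _).
by rewrite upd_upd upd_same// digitsK xk.
Qed.

Definition mxact n (X : 'M[C]_(dimt c n)) f : H :=
  \sum_j \sum_k X j k *: mxunit j k f.

Lemma mxactE n (X : 'M[C]_(dimt c n)) f x :
  mxact X f x = \sum_k X (idx (dig x) n) k * f (upd n (digits k) x).
Proof.
rewrite /mxact ell2_sumE (bigD1 (idx (dig x) n))//= [X in _ + X]big1 => [|j jx].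
  rewrite addr0 ell2_sumE; apply: eq_bigr => k _.
  by rewrite -[LHS]/(_ * mxunit_fun _ _ _ _) /mxunit_fun eqxx.
rewrite ell2_sumE big1// => k _.
by rewrite -[LHS]/(_ * mxunit_fun _ _ _ _) /mxunit_fun eq_sym (negbTE jx) mulr0.
Qed.

Lemma mxact_linearr n (X : 'M[C]_(dimt c n)) a f g :
  mxact X (a *: f + g) = a *: mxact X f + mxact X g.
Proof.
rewrite /mxact scaler_sumr -big_split; apply: eq_bigr => j _ /=.
rewrite scaler_sumr -big_split; apply: eq_bigr => k _ /=.
by rewrite mxunit_linear scalerDr !scalerA mulrC.
Qed.

Lemma mxact_linearl n a (X Y : 'M[C]_(dimt c n)) f :
  mxact (a *: X + Y) f = a *: mxact X f + mxact Y f.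
Proof.
rewrite /mxact scaler_sumr -big_split; apply: eq_bigr => j _ /=.
rewrite scaler_sumr -big_split; apply: eq_bigr => k _ /=.
by rewrite !mxE scalerDl scalerA.
Qed.

Lemma mxact_mul n (X Y : 'M[C]_(dimt c n)) f : mxact (X *m Y) f = mxact X (mxact Y f).
Proof.
apply: ell2_ext => x; rewrite !mxactE.
under [RHS]eq_bigr do rewrite mxactE mulr_sumr.
rewrite exchange_big; apply: eq_bigr => k _ /=; rewrite !mxE mulr_suml.
by apply: eq_bigr => j _; rewrite idx_upd digitsK upd_upd mulrA.
Qed.

Lemma mxact_one n f : mxact (1%:M : 'M[C]_(dimt c n)) f = f.
Proof.
apply: ell2_ext => x; rewrite mxactE (bigD1 (idx (dig x) n))//= big1 => [|k kx].
  by rewrite mxE eqxx mul1r addr0 upd_same// digitsK.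
by rewrite mxE eq_sym (negbTE kx) mul0r.
Qed.

Lemma mxact_delta n (j k : 'I_(dimt c n)) f : mxact (delta_mx j k) f = mxunit j k f.
Proof.
apply: ell2_ext => x; rewrite mxactE (bigD1 k)//= big1 => [|l lk].
  rewrite addr0 mxE eqxx andbT /mxunit_fun.
  by case: eqP => _; rewrite ?mul1r ?mul0r.
by rewrite mxE (negbTE lk) andbF mul0r.
Qed.

Lemma mxact_star n (X : 'M[C]_(dimt c n)) f g :
  dot (mxact (X ^t*)%sesqui f) g = dot f (mxact X g).
Proof.
rewrite /mxact dot_suml dot_sumr.
under eq_bigr do rewrite dot_suml; under [RHS]eq_bigr do rewrite dot_sumr.
rewrite exchange_big; apply: eq_bigr => j _; apply: eq_bigr => k _ /=.
by rewrite !mxE dotZl conjCK dotZr mxunit_adjoint.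
Qed.

(** A matrix X (x) 1 leaves digit n unchanged, so only the term of the sum
    in which digit n is that of x itself remains. *)
Lemma mxact_compat n (X : 'M[C]_(dimt c n)) f :
  mxact (X *t (1%:M : 'M[C]_(c n)) : 'M[C]_(dimt c n.+1)) f = mxact X f.
Proof.
apply: ell2_ext => x; rewrite !mxactE [idx _ n.+1]/=.
rewrite [LHS](@sum_mxtens _ (dimt c n) (c n)).
apply: eq_bigr => k _; rewrite (bigD1 (dig x n))// big1 => [|l lx].
  rewrite [LHS]addr0 tensmxE mxE eqxx mulr1 digitsS.
  rewrite upd_succ ?dfwithin//; congr (_ * f _); apply: eq_upd.
  by apply: eq_idx => i lt_in; rewrite dfwithout// gtn_eqF.
by rewrite tensmxE mxE eq_sym (negbTE lx) mulr0 mul0r.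
Qed.

End MatrixAction.

(** * Extending representations from matrices to the inductive limit *)

(** A *-representation of the union of the matrix algebras of the inductive
    system. The operators turn out to be bounded because each algebra is
    finite-dimensional. *)
Record local_rep (R : realType) (c : seq_ge2) (H : hilbertType R) := LocalRep {
  lrep :> (forall n, 'M[R[i]]_(dimt c n) -> H -> H);
  lrep_linearl : forall n a (X Y : 'M[R[i]]_(dimt c n)) u,
    lrep (a *: X + Y) u = a *: lrep X u + lrep Y u;
  lrep_linearr : forall n (X : 'M[R[i]]_(dimt c n)) a u v,
    lrep X (a *: u + v) = a *: lrep X u + lrep X v;
  lrep_mul : forall n (X Y : 'M[R[i]]_(dimt c n)) u, lrep (X *m Y) u = lrep X (lrep Y u);
  lrep_one : forall n u, lrep (1%:M : 'M[R[i]]_(dimt c n)) u = u;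
  lrep_star : forall n (X : 'M[R[i]]_(dimt c n)) u v,
    dot (lrep (X ^t*)%sesqui u) v = dot u (lrep X v);
  lrep_compat : forall n (X : 'M[R[i]]_(dimt c n)) u,
    @lrep n.+1 (X *t (1%:M : 'M[R[i]]_(c n))) u = lrep X u }.

Section LocalRepContractive.
Context {R : realType} {c : seq_ge2} (A : uhf R c) {H : hilbertType R}.
Variable P : local_rep c H.
Local Notation C := R[i].
Local Notation M n := 'M[C]_(dimt c n).

Lemma lrep0 n u : P n 0 u = 0.
Proof.
have := lrep_linearl P (-1) (0 : M n) 0 u.
by rewrite scaler0 addr0 scaleN1r addNr.
Qed.

Lemma lrepD n (X Y : M n) u : P n (X + Y) u = P n X u + P n Y u.
Proof. by rewrite -[X in P n (X + Y)]scale1r lrep_linearl scale1r. Qed.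

Lemma lrepZ n a (X : M n) u : P n (a *: X) u = a *: P n X u.
Proof. by rewrite -[X in P n X u]addr0 lrep_linearl lrep0 addr0. Qed.

Lemma lrepN n (X : M n) u : P n (- X) u = - P n X u.
Proof. by rewrite -scaleN1r lrepZ scaleN1r. Qed.

Lemma lrepB n (X Y : M n) u : P n (X - Y) u = P n X u - P n Y u.
Proof. by rewrite lrepD lrepN. Qed.

Lemma lrep_sum n (J : finType) (F : J -> M n) u :
  P n (\sum_j F j) u = \sum_j P n (F j) u.
Proof.
by apply: (big_morph (fun X => P n X u)) => [X Y|]; rewrite ?lrepD ?lrep0.
Qed.

Lemma lrepBr n (X : M n) u v : P n X (u - v) = P n X u - P n X v.
Proof.
by rewrite addrC -scaleN1r lrep_linearr scaleN1r addrC.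
Qed.

Lemma conj_delta n (j k : 'I_(dimt c n)) :
  ((delta_mx j k : M n) ^t*)%sesqui = delta_mx k j.
Proof. by apply/matrixP => a b; rewrite !mxE rmorph_nat andbC. Qed.

(** The C*-identity makes the norm of a nonzero projection equal to 1, and
    then that of a partial isometry between such projections. *)
Lemma in_delta_norm n (j k : 'I_(dimt c n)) :
  cnorm (uhf_in A n (delta_mx j k)) = 1.
Proof.
have proj i : cnorm (uhf_in A n (delta_mx i i)) = 1.
  set e := uhf_in A n _; have := cnorm_star e.
  have -> : star e * e = e.
    by rewrite -uhf_in_star -uhf_in_mul conj_delta mul_delta_mx.
  move=> ee; have eN0 : cnorm e != 0.
    apply/eqP => /cnorm_eq0; rewrite -[0](linear0 (uhf_in A n)).
    move=> /uhf_in_inj /matrixP/(_ i i); rewrite !mxE !eqxx => /eqP.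
    by rewrite oner_eq0.
  by apply: (mulfI eN0); rewrite mulr1 -expr2.
have := cnorm_star (uhf_in A n (delta_mx j k)).
rewrite -uhf_in_star -uhf_in_mul conj_delta mul_delta_mx proj => /esym/eqP.
by rewrite sqrp_eq1 ?cnorm_ge0// => /eqP.
Qed.

(** An entry is obtained by compressing with two projections of norm 1. *)
Lemma entry_le_cnorm n (X : M n) j k : rnorm (X j k) <= cnorm (uhf_in A n X).
Proof.
have e : delta_mx j j *m X *m delta_mx k k = X j k *: delta_mx j k.
  apply/matrixP => a b; rewrite !mxE (bigD1 k)//= big1 => [|l lk].
    rewrite addr0 !mxE eqxx /= (bigD1 j)//= big1 => [|l lj].
      rewrite addr0 !mxE eqxx andbT.
      by case: eqP; case: eqP; rewrite /= ?(mulr0, mul0r, mulr1, mul1r).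
    by rewrite mxE (negbTE lj) andbF mul0r.
  by rewrite [delta_mx k k _ _]mxE (negbTE lk) mulr0.
have : cnorm (uhf_in A n (X j k *: delta_mx j k)) <= cnorm (uhf_in A n X).
  rewrite -e !uhf_in_mul; apply: le_trans (cnormM _ _) _.
  rewrite in_delta_norm mulr1; apply: le_trans (cnormM _ _) _.
  by rewrite in_delta_norm mul1r.
by rewrite linearZ /= cnormZ in_delta_norm mulr1.
Qed.

Lemma lrep_delta_le n (j k : 'I_(dimt c n)) u :
  rnorm (P n (delta_mx j k) u) <= rnorm u.
Proof.
have sq a b v : rnorm (P n (delta_mx a b) v) ^+ 2 <= rnorm v * rnorm (P n (delta_mx b b) v).
  rewrite -[leLHS](rnorm_real (exprn_ge0 2 (rnorm_ge0 _))) -dot_rnorm -lrep_star.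
  rewrite conj_delta -lrep_mul mul_delta_mx mulrC; exact: dot_CauchySchwarz.
have pk v : rnorm (P n (delta_mx k k) v) <= rnorm v.
  have := sq k k v; have := rnorm_ge0 (P n (delta_mx k k) v); have := rnorm_ge0 v.
  nra.
have := sq j k u; have := pk u; have := rnorm_ge0 u.
have := rnorm_ge0 (P n (delta_mx j k) u); nra.
Qed.

(** The square of the dimension, in the form in which the estimate produces
    it. *)
Definition lrep_bound n : R := \sum_(j < dimt c n) \sum_(k < dimt c n) 1.

Lemma lrep_bounded n (X : M n) u :
  rnorm (P n X u) <= lrep_bound n * cnorm (uhf_in A n X) * rnorm u.
Proof.
rewrite [X in rnorm (P n X u)]matrix_sum_delta lrep_sum.
apply: le_trans (rnorm_sum _) _; rewrite /lrep_bound !mulr_suml.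
apply: ler_sum => j _; rewrite lrep_sum; apply: le_trans (rnorm_sum _) _.
apply: ler_sum => k _; rewrite lrepZ rnormZ mul1r.
by rewrite ler_pM ?rnorm_ge0 ?entry_le_cnorm ?lrep_delta_le.
Qed.

(** The same iteration inside the matrix algebra, so that the representation
    can be applied to its terms. *)
Fixpoint mx_sqrt_iter n (X : M n) k : M n :=
  if k is k'.+1 then 2^-1 *: (X + mx_sqrt_iter X k' *m mx_sqrt_iter X k') else 0.

Lemma in_mx_sqrt_iter n (X : M n) k :
  uhf_in A n (mx_sqrt_iter X k) = sqrt_iter (uhf_in A n X) k.
Proof.
elim: k => [|k IH] /=; first by rewrite linear0.
by rewrite linearZ linearD /= uhf_in_mul IH.
Qed.

(** As for [rep_contractive], but here 1 - h is only a limit of squares of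
    self-adjoint matrices. Each term of the iteration gives the inequality up to
    an error controlled by [lrep_bounded], and this error tends to 0. *)
Lemma lrep_contractive n (X : M n) u :
  rnorm (P n X u) <= cnorm (uhf_in A n X) * rnorm u.
Proof.
apply: le_scale_limit => [|s Xs]; first exact: rnorm_ge0.
have s0 : 0 < s by apply: le_lt_trans Xs; exact: cnorm_ge0.
pose S : C := (s ^- 2)%:C.
pose h : M n := S *: ((X ^t*)%sesqui *m X).
pose h' := uhf_in A n h.
have h'E : h' = S *: (star (uhf_in A n X) * uhf_in A n X).
  by rewrite /h' /h linearZ /= uhf_in_mul uhf_in_star.
have hh : star h' = h' by rewrite h'E starZ starM starK conj_real.
have h1 : cnorm h' < 1.
  rewrite h'E cnormZ -/(rnorm _) rnorm_real ?invr_ge0 ?exprn_ge0 ?(ltW s0)//.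
  rewrite cnorm_star mulrC ltr_pdivrMr ?exprn_gt0// mul1r.
  by rewrite ltr_pXn2r// nnegrE ?cnorm_ge0// ltW.
pose p := rnorm (P n X u); pose q := rnorm u; pose K := lrep_bound n.
have K0 : 0 <= K by do 2![apply: sumr_ge0 => ? _].
have step k : s ^- 2 * p ^+ 2 <= q ^+ 2 + K * (2 * cnorm h' ^+ k) * q ^+ 2.
  pose W : M n := 1%:M - mx_sqrt_iter h k.
  have inW : uhf_in A n W = 1 - sqrt_iter h' k.
    by rewrite linearB uhf_in_one in_mx_sqrt_iter.
  have WW : (W ^t*)%sesqui = W.
    by apply: (@uhf_in_inj _ _ A); rewrite uhf_in_star inW starB star1 sqrt_iter_star.
  have [E inE WE] : exists2 E : M n, cnorm (uhf_in A n E) <= 2 * cnorm h' ^+ k &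
      W *m W = E + (1%:M - h).
    exists (W *m W - (1%:M - h)); last by rewrite subrK.
    rewrite linearB [X in _ - X]linearB /= uhf_in_mul uhf_in_one inW.
    exact: (sqrt_iter_defect h1).
  have := dot_ge0 (P n W u); rewrite -lrep_star WW -lrep_mul WE.
  rewrite lrepD lrepB lrep_one lrepZ lrep_mul !dotDl dotNl dotZl conj_real.
  rewrite lrep_star !dot_rnorm -/p -/q -rmorphM -rmorphB.
  have dE : rnorm (dot (P n E u) u) <= K * (2 * cnorm h' ^+ k) * q ^+ 2.
    apply: le_trans (dot_CauchySchwarz _ _) _; rewrite expr2 mulrA.
    rewrite ler_wpM2r ?rnorm_ge0//; apply: le_trans (lrep_bounded _ _) _.
    by rewrite ler_wpM2r ?rnorm_ge0// ler_wpM2l.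
  rewrite lecE => /andP[_]; rewrite ReD /= => re.
  have := Re_le_rnorm (dot (P n E u) u); lra.
have {step} step : s ^- 2 * p ^+ 2 <= 1 * q ^+ 2.
  apply: le_scale_limit => [|t t1]; first by rewrite exprn_ge0// rnorm_ge0.
  have K1 : 0 < 2 * K + 1 by rewrite ltr_wpDl// mulr_ge0.
  have e0 : 0 < (t - 1) / (2 * K + 1) by rewrite divr_gt0// subr_gt0.
  have [k rk] := pow_small h1 e0; apply: le_trans (step k) _.
  have -> : q ^+ 2 + K * (2 * cnorm h' ^+ k) * q ^+ 2 =
      (1 + 2 * K * cnorm h' ^+ k) * q ^+ 2 by ring.
  rewrite ler_wpM2r ?exprn_ge0 ?rnorm_ge0//.
  rewrite -lerBrDl; apply: le_trans (_ : (2 * K + 1) * cnorm h' ^+ k <= _).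
    by rewrite ler_wpM2r ?exprn_ge0 ?cnorm_ge0// lerDl.
  by rewrite mulrC -ler_pdivlMr// ltW.
move: step; rewrite mul1r mulrC ler_pdivrMr ?exprn_gt0// mulrC -exprMn.
rewrite ler_pXn2r// nnegrE ?mulr_ge0 ?rnorm_ge0//.
by rewrite ltW.
Qed.

End LocalRepContractive.

Section Extension.
Context {R : realType} {c : seq_ge2} (A : uhf R c) {H : hilbertType R}.
Variable P : local_rep c H.
Local Notation C := R[i].
Local Notation M n := 'M[C]_(dimt c n).

(** Two matrices can be compared, added or multiplied after both are moved
    to a common level. *)
Lemma uhf_lift n m (X : M n) : (n <= m)%N -> exists Y : M m,
  uhf_in A m Y = uhf_in A n X /\ forall u, P m Y u = P n X u.
Proof.
move=> /subnK <-; elim: (m - n)%N => [|k [Y [YX PY]]]; first by exists X.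
exists (Y *t (1%:M : 'M[C]_(c (k + n)%N))); split.
  by rewrite -YX -(uhf_in_compat A Y).
by move=> u; rewrite -PY -(lrep_compat P Y).
Qed.

Lemma uhf_approx (x : A) e : 0 < e -> exists N, forall n, (N <= n)%N ->
  exists X : M n, cnorm (x - uhf_in A n X) < e.
Proof.
move=> e0; have [N [X xX]] := @uhf_dense _ _ A x e e0; exists N => n Nn.
by have [Y [YX _]] := uhf_lift X Nn; exists Y; rewrite YX.
Qed.

Lemma uhf_approx2 (x y : A) e : 0 < e -> exists n (X Y : M n),
  cnorm (x - uhf_in A n X) < e /\ cnorm (y - uhf_in A n Y) < e.
Proof.
move=> e0; have [N xN] := uhf_approx x e0; have [N' yN] := uhf_approx y e0.
have [X xX] := xN (maxn N N') (leq_maxl _ _).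
by have [Y yY] := yN (maxn N N') (leq_maxr _ _); exists (maxn N N'), X, Y.
Qed.

Lemma lrep_dist n m (X : M n) (Y : M m) u :
  rnorm (P n X u - P m Y u) <= cnorm (uhf_in A n X - uhf_in A m Y) * rnorm u.
Proof.
have [X' [<- PX]] := uhf_lift X (leq_maxl n m).
have [Y' [<- PY]] := uhf_lift Y (leq_maxr n m).
by rewrite -PX -PY -lrepB -linearB; exact: lrep_contractive.
Qed.

(** By contractivity, the images of u under matrices that approximate x form
    a Cauchy sequence. The inequality determines the limit and is the only
    property of it that is used. *)
Lemma rep_ext_subproof (x : A) u : exists g : H, forall n (X : M n),
  rnorm (g - P n X u) <= cnorm (x - uhf_in A n X) * rnorm u.
Proof.
have [F xF] : exists F : nat -> {n & M n}, forall k,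
    cnorm (x - uhf_in A (projT1 (F k)) (projT2 (F k))) < k.+1%:R^-1.
  suff /choice[F xF] : forall k, exists nX : {n & M n},
      cnorm (x - uhf_in A (projT1 nX) (projT2 nX)) < k.+1%:R^-1 by exists F.
  move=> k; have [|n [X xX]] := @uhf_dense _ _ A x k.+1%:R^-1.
    by rewrite invr_gt0.
  by exists (existT _ n X).
have small e : 0 < e -> exists N, forall k, (N <= k)%N ->
    cnorm (x - uhf_in A (projT1 (F k)) (projT2 (F k))) < e.
  move=> e0; have [N _ eN] := near_infty_natSinv_lt (PosNum e0).
  by exists N => k Nk; apply: lt_trans (xF k) (eN k Nk).
pose q := rnorm u; have q0 : 0 <= q := rnorm_ge0 u.
pose v k := P (projT1 (F k)) (projT2 (F k)) u.
have [g vg] : exists g, forall e : R, 0 < e -> exists N, forall n : nat,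
    (N <= n)%N -> rnorm (v n - g) < e.
  apply: complete_seq => e e0.
  have e1 : 0 < e / (2 * (q + 1)) by rewrite divr_gt0 ?mulr_gt0// ltr_wpDl.
  have [N eN] := small _ e1; exists N => m n Nm Nn.
  apply: le_lt_trans (lrep_dist _ _ _) _; rewrite -/q.
  apply: (@le_lt_trans _ _ (2 * (e / (2 * (q + 1))) * q)).
    rewrite ler_wpM2r//; apply: le_trans (cnormB _ _ x) _.
    by rewrite cnorm_distC mulrDl mul1r lerD// ltW ?eN.
  rewrite invfM mulrCA mulVKf// mulrAC ltr_pdivrMr ?ltr_wpDl//.
  by rewrite ltr_pM2l// ltrDl.
exists g => n X; apply: (@le_of_small R _ _ (1 + q)) => e e0.
have [N gN] := vg e e0; have [N' xN'] := small e e0.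
pose k := maxn N N'; apply: le_trans (rnormB _ _ (v k)) _.
have h1 : rnorm (g - v k) < e by rewrite rnorm_distC gN// leq_maxl.
have h2 : cnorm (x - uhf_in A (projT1 (F k)) (projT2 (F k))) < e.
  by rewrite xN'// leq_maxr.
have h3 : rnorm (v k - P n X u) <= (e + cnorm (x - uhf_in A n X)) * q.
  apply: le_trans (lrep_dist _ _ _) _; rewrite -/q ler_wpM2r//.
  by apply: le_trans (cnormB _ _ x) _; rewrite cnorm_distC lerD2r ltW.
rewrite -/q; lra.
Qed.

Definition rep_ext_fun (x : A) u : H := projT1 (cid (rep_ext_subproof x u)).

Lemma rep_ext_dist x u n (X : M n) :
  rnorm (rep_ext_fun x u - P n X u) <= cnorm (x - uhf_in A n X) * rnorm u.
Proof. by rewrite /rep_ext_fun; case: cid => g /= ->. Qed.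

Lemma rep_ext_in n (X : M n) u : rep_ext_fun (uhf_in A n X) u = P n X u.
Proof.
apply/eqP; rewrite -subr_eq0; apply/eqP/rnorm_eq0/eqP; rewrite eq_le rnorm_ge0 andbT.
by apply: le_trans (rep_ext_dist _ _ _) _; rewrite subrr cnorm0 mul0r.
Qed.

Lemma rep_ext_contractive x u : rnorm (rep_ext_fun x u) <= cnorm x * rnorm u.
Proof.
by have := rep_ext_dist x u (0 : M 0%N); rewrite lrep0 (linear0 (uhf_in A 0%N)) !subr0.
Qed.

Lemma eq_by_dist (u v : H) (K : R) :
  (forall e, 0 < e -> rnorm (u - v) <= e * K) -> u = v.
Proof.
by move=> /rnorm_small/eqP; rewrite subr_eq0 => /eqP.
Qed.

Lemma rep_ext_linearr x : linear (rep_ext_fun x).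
Proof.
move=> a u v; apply: (@eq_by_dist _ _
  (rnorm (a *: u + v) + (rnorm a * rnorm u + rnorm v))) => e e0.
have [n [X xX]] := @uhf_dense _ _ A x e e0.
apply: le_trans (rnormB _ _ (P n X (a *: u + v))) _.
rewrite mulrDr lerD//.
  by apply: le_trans (rep_ext_dist _ _ _) _; rewrite ler_wpM2r ?rnorm_ge0// ltW.
rewrite lrep_linearr opprD addrACA -scalerBr; apply: le_trans (rnormD _ _) _.
rewrite rnormZ mulrDr mulrCA lerD//.
  rewrite ler_wpM2l ?rnorm_ge0// rnorm_distC; apply: le_trans (rep_ext_dist _ _ _) _.
  by rewrite ler_wpM2r ?rnorm_ge0// ltW.
rewrite rnorm_distC; apply: le_trans (rep_ext_dist _ _ _) _.
by rewrite ler_wpM2r ?rnorm_ge0// ltW.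
Qed.

HB.instance Definition _ x :=
  GRing.isLinear.Build C H H *:%R (rep_ext_fun x) (rep_ext_linearr x).

Lemma rep_ext_continuous x : continuous (rep_ext_fun x).
Proof.
apply/linear_bounded_continuous/linear_boundedP.
exists (cnorm x)%:C; split=> [|r xr u]; first by apply/complex_realP; exists (cnorm x).
apply: le_trans (_ : (cnorm x)%:C * `|u| <= _); last by rewrite ler_wpM2r// ltW.
by rewrite !rnormE -rmorphM lecR; exact: rep_ext_contractive.
Qed.

Lemma rep_ext_dist_lt x u e n (X : M n) : cnorm (x - uhf_in A n X) < e ->
  rnorm (rep_ext_fun x u - P n X u) <= e * rnorm u.
Proof.
move=> xX; apply: le_trans (rep_ext_dist _ _ _) _.
by rewrite ler_wpM2r ?rnorm_ge0// ltW.
Qed.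

Lemma rep_ext_linear a x y u :
  rep_ext_fun (a *: x + y) u = a *: rep_ext_fun x u + rep_ext_fun y u.
Proof.
apply: (@eq_by_dist _ _ ((rnorm a + 1) * rnorm u + (rnorm a * rnorm u + rnorm u))) => e e0.
have [n [X [Y [xX yY]]]] := uhf_approx2 x y e0.
apply: le_trans (rnormB _ _ (P n (a *: X + Y) u)) _.
rewrite mulrDr lerD//.
  apply: le_trans (rep_ext_dist _ _ _) _; rewrite mulrA ler_wpM2r ?rnorm_ge0//.
  rewrite linearD linearZ /= opprD addrACA -scalerBr; apply: le_trans (cnormD _ _) _.
  rewrite cnormZ -/(rnorm a) mulrDr mulr1 mulrC lerD//; last exact: ltW.
  by rewrite ler_wpM2r ?rnorm_ge0// ltW.
rewrite lrep_linearl opprD addrACA -scalerBr; apply: le_trans (rnormD _ _) _.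
rewrite rnormZ mulrDr mulrCA lerD//.
  by rewrite ler_wpM2l ?rnorm_ge0// rnorm_distC rep_ext_dist_lt.
by rewrite rnorm_distC rep_ext_dist_lt.
Qed.

Lemma rep_ext_mul x y u : rep_ext_fun (x * y) u = rep_ext_fun x (rep_ext_fun y u).
Proof.
set w := rep_ext_fun y u.
apply/esym/eqP; rewrite -subr_eq0; apply/eqP/(@rnorm_small R _ _
  (rnorm w + (cnorm x + 1) * rnorm u + (cnorm y + (cnorm x + 1)) * rnorm u)) => e' e'0.
wlog e1 : e' e'0 / e' <= 1 => [th|].
  have [|/ltW e1] := leP e' 1; first exact: th.
  have := th 1 ltr01 (lexx _); rewrite mul1r => h; apply: le_trans h _.
  rewrite ler_peMl// !addr_ge0 ?mulr_ge0 ?addr_ge0 ?rnorm_ge0 ?cnorm_ge0//.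
pose e := e'; have e0 : 0 < e := e'0; rewrite -/e in e1 *.
have [n [X [Y [xX yY]]]] := uhf_approx2 x y e0.
have Xle : cnorm (uhf_in A n X) <= cnorm x + 1.
  have := cnormD (uhf_in A n X - x) x; rewrite subrK cnorm_distC; lra.
have h1 : rnorm (rep_ext_fun x w - P n X w) <= e * rnorm w by exact: rep_ext_dist_lt.
have h2 : rnorm (P n X w - P n X (P n Y u)) <= (cnorm x + 1) * (e * rnorm u).
  rewrite -lrepBr; apply: le_trans (lrep_contractive A _ _ _) _.
  by rewrite ler_pM ?cnorm_ge0 ?rnorm_ge0// rep_ext_dist_lt.
have h3 : rnorm (P n X (P n Y u) - rep_ext_fun (x * y) u) <=
    (e * cnorm y + (cnorm x + 1) * e) * rnorm u.
  rewrite -lrep_mul rnorm_distC; apply: le_trans (rep_ext_dist _ _ _) _.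
  rewrite ler_wpM2r ?rnorm_ge0// uhf_in_mul.
  apply: le_trans (cnormB _ _ (uhf_in A n X * y)) _.
  rewrite -mulrBl -mulrBr lerD//.
    by apply: le_trans (cnormM _ _) _; rewrite ler_wpM2r ?cnorm_ge0// ltW.
  by apply: le_trans (cnormM _ _) _; rewrite ler_pM ?cnorm_ge0// ltW.
have := rnormB (rep_ext_fun x w) (rep_ext_fun (x * y) u) (P n X w).
have := rnormB (P n X w) (rep_ext_fun (x * y) u) (P n X (P n Y u)).
lra.
Qed.

Lemma rep_ext_one u : rep_ext_fun 1 u = u.
Proof. by rewrite -(uhf_in_one A 0%N) rep_ext_in lrep_one. Qed.

Lemma rep_ext_star x u v : dot (rep_ext_fun (star x) u) v = dot u (rep_ext_fun x v).
Proof.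
apply/eqP; rewrite -subr_eq0; apply/eqP/(@rnorm_small R _ _
  (rnorm u * rnorm v + rnorm u * rnorm v)) => e e0.
have [n [X xX]] := @uhf_dense _ _ A x e e0.
apply: le_trans (rnormB _ _ (dot u (P n X v))) _; rewrite mulrDr lerD//.
  rewrite -lrep_star -dotNl -dotDl; apply: le_trans (dot_CauchySchwarz _ _) _.
  rewrite mulrA ler_wpM2r ?rnorm_ge0// rep_ext_dist_lt//.
  by rewrite uhf_in_star -starB cnorm_starE.
rewrite -dotNr -dotDr; apply: le_trans (dot_CauchySchwarz _ _) _.
by rewrite mulrCA ler_wpM2l ?rnorm_ge0// rnorm_distC rep_ext_dist_lt.
Qed.

Definition rep_ext : rep A :=
  @Rep R A H (fun x => rep_ext_fun x) rep_ext_continuous rep_ext_linear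
    rep_ext_mul rep_ext_one rep_ext_star.

Lemma rep_extE n (X : M n) u : rep_ext (uhf_in A n X) u = P n X u.
Proof. exact: rep_ext_in. Qed.

End Extension.

Section BasisRep.
Context {R : realType} {c : seq_ge2}.

Definition mx_local_rep (I : indexing c) : local_rep c (ell2 R I) :=
  @LocalRep R c (ell2 R I) (@mxact R c I) mxact_linearl mxact_linearr mxact_mul
    mxact_one mxact_star mxact_compat.

Variable A : uhf R c.

Definition basis_rep (I : indexing c) : rep A := rep_ext A (mx_local_rep I).

Lemma basis_rep_delta (I : indexing c) n j k f :
  basis_rep I (uhf_in A n (delta_mx j k)) f = mxunit j k f.
Proof. by rewrite -mxact_delta -[RHS]/(mx_local_rep I n _ _) -rep_extE. Qed.

End BasisRep.

(** * Basis vectors and tensor products of square-summable functions *)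

Section Polarization.
Context {R : realType}.
Local Notation C := R[i].
Variables (V : lmodType C) (D : V -> V -> C).
Hypothesis DDr : forall u v w, D u (v + w) = D u v + D u w.
Hypothesis DDl : forall u v w, D (u + v) w = D u w + D v w.
Hypothesis DZr : forall c u v, D u (c *: v) = c * D u v.
Hypothesis DZl : forall c u v, D (c *: u) v = c^* * D u v.
Hypothesis D_diag : forall u, D u u = 0.

(** A sesquilinear form is determined by its values on the diagonal, over
    the complex numbers. *)
Lemma polarization u v : D u v = 0.
Proof.
have anti w : D u w = - D w u.
  by have /eqP := D_diag (u + w); rewrite DDr !DDl !D_diag add0r addr0 addrC addr_eq0 => /eqP.
have := anti ('i *: v); rewrite DZr DZl conjCi mulNr opprK => /(mulfI (neq0Ci _)) e.
have := anti v; rewrite -e => /eqP; rewrite -addr_eq0 -mulr2n mulrn_eq0 /=.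
by move=> /eqP.
Qed.

End Polarization.

Section Ell2Basis.
Context {R : realType} {I : choiceType}.
Local Notation C := R[i].
Local Notation H := (ell2 R I).

Definition basis_fun (x y : I) : C := (x == y)%:R.

Lemma basis_sqn x y : sqn (basis_fun x y) = (x == y)%:R.
Proof.
by rewrite /basis_fun /sqn; case: (x == y); rewrite /= ?expr1n ?expr0n /= addr0.
Qed.

Lemma sum_basis_sqn x s : uniq s ->
  \sum_(y <- s) sqn (basis_fun x y) = (x \in s)%:R.
Proof.
move=> us; under eq_bigr do rewrite basis_sqn.
have [xs|xs] := boolP (x \in s).
  rewrite (bigD1_seq x)//= eqxx big1 ?addr0// => y yx.
  by rewrite eq_sym (negbTE yx).
rewrite big_seq big1// => y ys; case: eqP => // xy.
by rewrite xy ys in xs.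
Qed.

Fact basis_summable x : basis_fun x \in @sq_summable R I.
Proof.
apply: (@abs_summable_bound _ _ _ 1) => s us.
under eq_bigr do rewrite (ger0_norm (sqn_ge0 _)).
by rewrite sum_basis_sqn//; case: (x \in s); rewrite ?ler01.
Qed.

Definition basis x : H := Ell2 (basis_summable x).

Lemma basis_norm x : rnorm (basis x) = 1.
Proof.
have : rsum (fun y => sqn (basis x y)) = 1.
  apply/eqP; rewrite eq_le; apply/andP; split.
    apply: rsum_le => [y|s us]; first exact: sqn_ge0.
    by rewrite sum_basis_sqn//; case: (x \in s); rewrite ?ler01.
  apply: le_trans (term_le_rsum x _ _).
  - by rewrite basis_sqn eqxx.
  - by move=> y; exact: sqn_ge0.
  - exact: ell2_summable.
move=> r1; apply/eqP; rewrite -sqrp_eq1 ?rnorm_ge0//; apply/eqP/complexI.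
by rewrite -dot_rnorm -[LHS]/(ell2_dot _ _) ell2_dotE r1.
Qed.

Lemma sum_basisE (f : H) s x : uniq s ->
  (\sum_(y <- s) f y *: basis y : H) x = if x \in s then f x else 0.
Proof.
move=> us; rewrite (big_morph (fun g : H => g x) (id1 := 0) (op1 := +%R))//.
have e y : (f y *: basis y : H) x = f y * (y == x)%:R by [].
under eq_bigr do rewrite e.
case: ifPn => xs.
  rewrite (bigD1_seq x)//= eqxx mulr1 big1 ?addr0// => y yx.
  by rewrite (negbTE yx) mulr0.
rewrite big_seq big1// => y ys; case: eqP => [yx|]; last by rewrite mulr0.
by rewrite -yx ys in xs.
Qed.

(** Since the squared norm is a supremum of partial sums, a finite set of
    coordinates carries all of it up to e^2. *)
Lemma ell2_approx (f : H) e : 0 < e -> exists s : seq I,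
  rnorm (f - \sum_(y <- s) f y *: basis y) < e.
Proof.
move=> e0; pose h x := sqn (f x); have h0 x : 0 <= h x := sqn_ge0 _.
have sh : abs_summable h := ell2_summable f.
have e2 : 0 < e ^+ 2 by rewrite exprn_gt0.
have [s us hs] : exists2 s, uniq s & rsum h - e ^+ 2 < \sum_(x <- s) h x.
  apply: contrapT => no; have : rsum h <= rsum h - e ^+ 2.
    apply: rsum_le => // s us; rewrite leNgt; apply/negP => hs.
    by apply: no; exists s.
  lra.
exists s; rewrite -(ltr_pXn2r (n := 2)) ?nnegrE ?rnorm_ge0 ?ltW//.
rewrite -ltcR rmorphXn /= -rnormE ell2_normE ltcR.
pose h1 x := if x \in s then h x else 0.
pose h2 x := if x \in s then 0 else h x.
have -> : (fun x => sqn ((f - \sum_(y <- s) f y *: basis y) x)) = h2.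
  apply/funext => x; rewrite -[LHS]/(sqn (f x - (\sum_(y <- s) f y *: basis y) x)).
  by rewrite sum_basisE// /h2; case: ifP; rewrite ?subrr ?subr0 ?sqn0.
have sh1 : abs_summable h1.
  apply: abs_summable_le sh => x; rewrite /h1; case: ifP => // _.
  by rewrite normr0.
have sh2 : abs_summable h2.
  apply: abs_summable_le sh => x; rewrite /h2; case: ifP => // _.
  by rewrite normr0.
have eh : rsum h = rsum h1 + rsum h2.
  rewrite -rsumD//; congr rsum; apply/funext => x; rewrite /h1 /h2.
  by case: ifP; rewrite ?addr0 ?add0r.
have : \sum_(x <- s) h x <= rsum h1.
  rewrite big_seq (eq_bigr h1) -?big_seq; last by move=> x xs; rewrite /h1 xs.
  by apply: sum_le_rsum => // x; rewrite /h1; case: ifP.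
lra.
Qed.

End Ell2Basis.

Section Ell2Tensor.
Context {R : realType} {I J : choiceType}.
Local Notation C := R[i].
Implicit Types (f : ell2 R I) (g : ell2 R J).

(** Fubini for nonnegative families. *)
Lemma rsum_prod (h : I -> R) (k : J -> R) :
  (forall i, 0 <= h i) -> (forall j, 0 <= k j) -> abs_summable h -> abs_summable k ->
  (\esum_(p in [set: I * J]) (h p.1 * k p.2)%:E = (rsum h * rsum k)%:E)%E.
Proof.
move=> h0 k0 sh sk.
have -> : [set: I * J] = [set: I] `*`` (fun=> [set: J]) by apply/seteqP; split.
rewrite -(esum_esum (a := fun i j => (h i * k j)%:E)); last first.
  by move=> i j _ _; rewrite lee_fin mulr_ge0.
rewrite (eq_esum (b := fun i => (rsum k * h i)%:E)); last first.
  move=> i _; rewrite -rsum_ge0E ?rsumZ ?[rsum k * _]mulrC//.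
  - by move=> j; rewrite mulr_ge0.
  - exact: abs_summableZ.
rewrite -rsum_ge0E ?rsumZ ?[rsum k * _]mulrC//.
- by move=> i; rewrite mulr_ge0// rsum_ge0.
- exact: abs_summableZ.
Qed.

Definition tensor_fun f g (p : I * J) : C := f p.1 * g p.2.

Lemma esum_tensor f g :
  (\esum_(p in [set: I * J]) (sqn (tensor_fun f g p))%:E =
   (rsum (fun i => sqn (f i)) * rsum (fun j => sqn (g j)))%:E)%E.
Proof.
rewrite -rsum_prod; try (by move=> i; exact: sqn_ge0); try exact: ell2_summable.
by apply: eq_esum => p _; rewrite sqnM.
Qed.

Fact tensor_summable f g : tensor_fun f g \in @sq_summable R (I * J)%type.
Proof.
rewrite unfold_in /abs_summable /summable.
rewrite (eq_esum (b := fun p => (sqn (tensor_fun f g p))%:E)).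
  by rewrite esum_tensor ltry.
by move=> p _; rewrite abse_EFin ger0_norm// sqn_ge0.
Qed.

Definition ell2_tensor f g : ell2 R (I * J)%type := Ell2 (tensor_summable f g).

Lemma ell2_tensor_linearl g : linear (ell2_tensor ^~ g).
Proof.
move=> a f f'; apply: ell2_ext => p.
by rewrite -[LHS]/((a * f p.1 + f' p.1) * g p.2) mulrDl -mulrA.
Qed.

Lemma ell2_tensor_linearr f : linear (ell2_tensor f).
Proof.
move=> a g g'; apply: ell2_ext => p.
by rewrite -[LHS]/(f p.1 * (a * g p.2 + g' p.2)) mulrDr mulrCA.
Qed.

Lemma ell2_tensorDl f f' g : ell2_tensor (f + f') g = ell2_tensor f g + ell2_tensor f' g.
Proof. by rewrite -[f]scale1r ell2_tensor_linearl !scale1r. Qed.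

Lemma ell2_tensorDr f g g' : ell2_tensor f (g + g') = ell2_tensor f g + ell2_tensor f g'.
Proof. by rewrite -[g]scale1r ell2_tensor_linearr !scale1r. Qed.

Lemma ell2_tensor0l g : ell2_tensor 0 g = 0.
Proof. by apply: (addIr (ell2_tensor 0 g)); rewrite -ell2_tensorDl !add0r. Qed.

Lemma ell2_tensor0r f : ell2_tensor f 0 = 0.
Proof. by apply: (addIr (ell2_tensor f 0)); rewrite -ell2_tensorDr !add0r. Qed.

Lemma ell2_tensorZl c f g : ell2_tensor (c *: f) g = c *: ell2_tensor f g.
Proof. by rewrite -[c *: f]addr0 ell2_tensor_linearl ell2_tensor0l addr0. Qed.

Lemma ell2_tensorZr c f g : ell2_tensor f (c *: g) = c *: ell2_tensor f g.
Proof. by rewrite -[c *: g]addr0 ell2_tensor_linearr ell2_tensor0r addr0. Qed.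

Lemma ell2_tensor_norm f g :
  dot (ell2_tensor f g) (ell2_tensor f g) = dot f f * dot g g.
Proof.
rewrite -![dot _ _]/(ell2_dot _ _) !ell2_dotE -rmorphM; congr (real_complex _).
have := esum_tensor f g; rewrite -rsum_ge0E => [[->]//|p|].
- exact: sqn_ge0.
- exact: (tensor_summable f g).
Qed.

(** Only the norm of f (x) g is computed from sums; polarization in the
    first factor, then in the second, gives the inner products. *)
Lemma ell2_tensor_dot f g f' g' :
  dot (ell2_tensor f g) (ell2_tensor f' g') = dot f f' * dot g g'.
Proof.
have step u v h : dot (ell2_tensor u h) (ell2_tensor v h) = dot u v * dot h h.
  apply/eqP; rewrite -subr_eq0; apply/eqP.
  apply: (@polarization R _ (fun u v =>
    dot (ell2_tensor u h) (ell2_tensor v h) - dot u v * dot h h)).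
  - by move=> x y z; rewrite ell2_tensorDl !dotDr; ring.
  - by move=> x y z; rewrite ell2_tensorDl !dotDl; ring.
  - by move=> c x y; rewrite ell2_tensorZl !dotZr; ring.
  - by move=> c x y; rewrite ell2_tensorZl !dotZl; ring.
  - by move=> x; rewrite ell2_tensor_norm subrr.
apply/eqP; rewrite -subr_eq0; apply/eqP.
apply: (@polarization R _ (fun g g' =>
  dot (ell2_tensor f g) (ell2_tensor f' g') - dot f f' * dot g g')).
- by move=> x y z; rewrite ell2_tensorDr !dotDr; ring.
- by move=> x y z; rewrite ell2_tensorDr !dotDl; ring.
- by move=> c x y; rewrite ell2_tensorZr !dotZr; ring.
- by move=> c x y; rewrite ell2_tensorZr !dotZl; ring.
- by move=> x; rewrite step subrr.
Qed.

Lemma ell2_tensor_hilbert : is_hilbert_tensor ell2_tensor.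
Proof.
split.
- exact: ell2_tensor_linearl.
- exact: ell2_tensor_linearr.
- by move=> *; exact: ell2_tensor_dot.
move=> O [w Ow] Oopen.
have /nbhs_ballP[e /real_of_pos[r r0 ->] eO] := open_nbhs_nbhs (conj Oopen Ow).
have [s ws] := ell2_approx w r0.
exists (\sum_(p <- s) w p *: basis p); split.
  by apply: eO; rewrite -ball_normE /= rnormE ltcR.
exists [seq (w p *: basis p.1, basis p.2) | p <- s].
rewrite big_map; apply: eq_bigr => p _ /=; apply: ell2_ext => q.
rewrite -[LHS]/(w p * (p == q)%:R) -[RHS]/((w p * (p.1 == q.1)%:R) * (p.2 == q.2)%:R).
by rewrite -mulrA -natrM mulnb -xpair_eqE; case: p q => ? ? [].
Qed.

End Ell2Tensor.

(** * Tensor products of the basis representations *)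

Section RepAlgebra.
Context {R : realType} {A : cstarAlgType R}.
Variable pi : rep A.
Implicit Types x y : A.

Lemma rep0 u : pi 0 u = 0.
Proof.
apply/rnorm_eq0/eqP; rewrite eq_le rnorm_ge0 andbT.
by rewrite -(mul0r (rnorm u)) -(@cnorm0 _ A) rep_contractive.
Qed.

Lemma repD x y u : pi (x + y) u = pi x u + pi y u.
Proof. by have := @rep_linear _ _ pi 1 x y u; rewrite !scale1r. Qed.

Lemma repZ c x u : pi (c *: x) u = c *: pi x u.
Proof. by have := @rep_linear _ _ pi c x 0 u; rewrite rep0 !addr0. Qed.

Lemma repB x y u : pi (x - y) u = pi x u - pi y u.
Proof. by rewrite -[- y]scaleN1r repD repZ scaleN1r. Qed.

Lemma rep_sum (J : finType) (F : J -> A) u : pi (\sum_j F j) u = \sum_j pi (F j) u.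
Proof. by apply: (big_morph (fun x => pi x u)) => [x y|]; rewrite ?repD ?rep0. Qed.

End RepAlgebra.

Section Intertwiner.
Context {R : realType} {c : seq_ge2} (A : uhf R c) (pi rho : rep A).
Local Notation C := R[i].
Variables (V : rep_space pi -> rep_space rho) (K : R).
Hypothesis V_linear : linear V.
Hypothesis V_bounded : forall u, rnorm (V u) <= K * rnorm u.
Hypothesis V_delta : forall n (j k : 'I_(dimt c n)) u,
  V (pi (uhf_in A n (delta_mx j k)) u) = rho (uhf_in A n (delta_mx j k)) (V u).

(** Both sides are continuous in x because representations are contractive,
    and linear combinations of matrix units are dense. *)
Lemma intertwine x u : V (pi x u) = rho x (V u).
Proof.
have VD v w : V (v + w) = V v + V w.
  by have := V_linear 1 v w; rewrite !scale1r.
have V0 : V 0 = 0 by apply: (addIr (V 0)); rewrite -VD !add0r.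
have VZ a v : V (a *: v) = a *: V v.
  by have := V_linear a v 0; rewrite V0 !addr0.
have VB v w : V (v - w) = V v - V w by rewrite -[- w]scaleN1r VD VZ scaleN1r.
have Vsum (J : finType) (F : J -> rep_space pi) : V (\sum_j F j) = \sum_j V (F j).
  exact: (big_morph V VD V0).
have V_mx n (X : 'M[C]_(dimt c n)) v :
    V (pi (uhf_in A n X) v) = rho (uhf_in A n X) (V v).
  rewrite [X]matrix_sum_delta linear_sum !rep_sum Vsum; apply: eq_bigr => j _.
  rewrite linear_sum !rep_sum Vsum; apply: eq_bigr => k _.
  by rewrite linearZ /= !repZ VZ V_delta.
apply/eqP; rewrite -subr_eq0; apply/eqP.
apply: (@rnorm_small _ _ _ (`|K| * rnorm u + rnorm (V u))) => e e0.
have [n [X xX]] := @uhf_dense _ _ A x e e0.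
apply: le_trans (rnormB _ _ (V (pi (uhf_in A n X) u))) _; rewrite mulrDr lerD//.
  rewrite -VB -repB; apply: le_trans (V_bounded _) _.
  apply: le_trans (_ : `|K| * rnorm (pi (x - uhf_in A n X) u) <= _).
    by rewrite ler_wpM2r ?rnorm_ge0// ler_norm.
  rewrite mulrCA ler_wpM2l//.
  apply: le_trans (@rep_contractive _ _ pi (x - uhf_in A n X) u) _.
  by rewrite ler_wpM2r ?rnorm_ge0// ltW.
rewrite V_mx -repB.
apply: le_trans (@rep_contractive _ _ rho (uhf_in A n X - x) (V u)) _.
by rewrite ler_wpM2r ?rnorm_ge0// cnorm_distC ltW.
Qed.

End Intertwiner.

Section PushRep.
Context {R : realType} {A B : cstarAlgType R}.
Variables (f : star_iso A B) (pi : rep A).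

Lemma iso_inverse : exists g : B -> A, cancel f g /\ cancel g f.
Proof. by have [g fK gK] := iso_bij f; exists g. Qed.

Definition iso_inv : B -> A := projT1 (cid iso_inverse).

Lemma isoK : cancel f iso_inv.
Proof. by rewrite /iso_inv; case: cid => g []. Qed.

Lemma iso_invK : cancel iso_inv f.
Proof. by rewrite /iso_inv; case: cid => g []. Qed.

Let f_inj : injective f := can_inj isoK.

Definition push_op (x : B) : {linear rep_space pi -> rep_space pi} := pi (iso_inv x).

Fact push_continuous x : continuous (push_op x).
Proof. exact: rep_continuous. Qed.

Fact push_linear a x y u : push_op (a *: x + y) u = a *: push_op x u + push_op y u.
Proof.
rewrite /push_op -rep_linear; congr (pi _ u).
by apply: f_inj; rewrite linearP /= !iso_invK.
Qed.

Fact push_mul x y u : push_op (x * y) u = push_op x (push_op y u).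
Proof.
rewrite /push_op -rep_mul; congr (pi _ u).
by apply: f_inj; rewrite rmorphM /= !iso_invK.
Qed.

Fact push_one u : push_op 1 u = u.
Proof.
rewrite /push_op -[RHS](@rep_one _ _ pi); congr (pi _ u).
by apply: f_inj; rewrite rmorph1 iso_invK.
Qed.

Fact push_star x u v : dot (push_op (star x) u) v = dot u (push_op x v).
Proof.
rewrite /push_op -rep_star; congr (dot (pi _ u) v).
by apply: f_inj; rewrite iso_star !iso_invK.
Qed.

(** Transport along the inverse of an isomorphism. *)
Definition push_rep : rep B :=
  Rep push_continuous push_linear push_mul push_one push_star.

Lemma push_repE x u : push_rep (f x) u = pi x u.
Proof. by rewrite /= /push_op isoK. Qed.

End PushRep.

Section Slices.
Context {R : realType} {A B : cstarAlgType R} {T : min_tensor A B}.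
Variable sigma : rep T.

Lemma tens_suml (J : finType) (F : J -> A) y :
  mt_tens T (\sum_j F j) y = \sum_j mt_tens T (F j) y.
Proof.
have D x x' : mt_tens T (x + x') y = mt_tens T x y + mt_tens T x' y.
  by have := mt_linearl T y 1 x x'; rewrite !scale1r.
apply: (big_morph (fun x => mt_tens T x y) D).
by have := mt_linearl T y (-1) 0 0; rewrite !scaleN1r oppr0 addr0 addNr.
Qed.

Lemma tens_sumr (J : finType) (F : J -> B) x :
  mt_tens T x (\sum_j F j) = \sum_j mt_tens T x (F j).
Proof.
have D y y' : mt_tens T x (y + y') = mt_tens T x y + mt_tens T x y'.
  by have := mt_linearr T x 1 y y'; rewrite !scale1r.
apply: (big_morph (fun y => mt_tens T x y) D).
by have := mt_linearr T x (-1) 0 0; rewrite !scaleN1r oppr0 addr0 addNr.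
Qed.

(** The restriction of sigma to the first tensor factor is a representation
    of A, hence contractive. This gives continuity in each tensor factor. *)
Definition slicel_op (x : A) : {linear rep_space sigma -> rep_space sigma} :=
  sigma (mt_tens T x 1).

Fact slicel_continuous x : continuous (slicel_op x).
Proof. exact: rep_continuous. Qed.

Fact slicel_linear a x y u : slicel_op (a *: x + y) u = a *: slicel_op x u + slicel_op y u.
Proof. by rewrite /slicel_op (mt_linearl T 1) rep_linear. Qed.

Fact slicel_mul x y u : slicel_op (x * y) u = slicel_op x (slicel_op y u).
Proof. by rewrite /slicel_op -rep_mul mt_mul mulr1. Qed.

Fact slicel_one u : slicel_op 1 u = u.
Proof. by rewrite /slicel_op mt_one rep_one. Qed.

Fact slicel_star x u v : dot (slicel_op (star x) u) v = dot u (slicel_op x v).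
Proof. by rewrite /slicel_op -rep_star mt_star star1. Qed.

Definition slicel : rep A :=
  Rep slicel_continuous slicel_linear slicel_mul slicel_one slicel_star.

Definition slicer_op (y : B) : {linear rep_space sigma -> rep_space sigma} :=
  sigma (mt_tens T 1 y).

Fact slicer_continuous x : continuous (slicer_op x).
Proof. exact: rep_continuous. Qed.

Fact slicer_linear a x y u : slicer_op (a *: x + y) u = a *: slicer_op x u + slicer_op y u.
Proof. by rewrite /slicer_op (mt_linearr T 1) rep_linear. Qed.

Fact slicer_mul x y u : slicer_op (x * y) u = slicer_op x (slicer_op y u).
Proof. by rewrite /slicer_op -rep_mul mt_mul mulr1. Qed.

Fact slicer_one u : slicer_op 1 u = u.
Proof. by rewrite /slicer_op mt_one rep_one. Qed.

Fact slicer_star x u v : dot (slicer_op (star x) u) v = dot u (slicer_op x v).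
Proof. by rewrite /slicer_op -rep_star mt_star star1. Qed.

Definition slicer : rep B :=
  Rep slicer_continuous slicer_linear slicer_mul slicer_one slicer_star.

End Slices.

Section TensorRep.
Context {R : realType} {a b : seq_ge2} {Aa : uhf R a} {Ab : uhf R b}.
Context {Aab : uhf R (muls a b)} {T : min_tensor Aa Ab}.
Variable phi : phi_iso Aab T.
Local Notation C := R[i].

Definition join_idx n (j : 'I_(dimt a n)) (l : 'I_(dimt b n)) : 'I_(dimt (muls a b) n) :=
  idx (join_digits (digits j) (digits l)) n.

Lemma phi_delta n (j k : 'I_(dimt a n)) (l m : 'I_(dimt b n)) :
  phi (uhf_in Aab n (delta_mx (join_idx j l) (join_idx k m))) =
  mt_tens T (uhf_in Aa n (delta_mx j k)) (uhf_in Ab n (delta_mx l m)).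
Proof.
have := phiE phi n (digits j) (digits k) (digits l) (digits m).
rewrite (tensn_delta (c := a)) (tensn_delta (c := b)).
rewrite (tensn_delta (c := muls a b) (join_digits (digits j) (digits l))
  (join_digits (digits k) (digits m))).
by rewrite !digitsK.
Qed.

Variables (I : indexing a) (J : indexing b).

Definition product_rep : rep T :=
  push_rep phi (basis_rep Aab (prod_indexing I J)).

Let pi1 := basis_rep Aa I.
Let pi2 := basis_rep Ab J.

(** The first n pairs of digits lie in row (j, l) if and only if the digits
    of x lie in row j and those of y in row l. *)
Lemma mxunit_tensor n (j k : 'I_(dimt a n)) (l m : 'I_(dimt b n))
  (f : ell2 R I) (g : ell2 R J) :
  @mxunit R (muls a b) (prod_indexing I J) n (join_idx j l) (join_idx k m) (ell2_tensor f g) =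
  ell2_tensor (mxunit j k f) (mxunit l m g).
Proof.
apply: ell2_ext => -[x y]; rewrite -[RHS]/(mxunit_fun j k f x * mxunit_fun l m g y).
rewrite -[LHS]/(mxunit_fun (I := prod_indexing I J) _ _ _ (x, y)) /mxunit_fun.
have -> : (idx (dig ((x, y) : prod_indexing I J)) n == join_idx j l) =
    (idx (dig x) n == j) && (idx (dig y) n == l).
  by rewrite [LHS](idx_join_eq (dig x) (dig y)) !digitsK.
have -> : upd n (digits (join_idx k m)) ((x, y) : prod_indexing I J) =
    (upd n (digits k) x, upd n (digits m) y).
  rewrite (eq_upd (z := join_digits (digits k) (digits m))); last by rewrite digitsK.
  by rewrite -[LHS]/(upd n (ldigits _) x, upd n (rdigits _) y) ldigits_join rdigits_join.
by case: eqP => _; case: eqP => _; rewrite /= ?mul0r ?mulr0.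
Qed.

Lemma product_rep_delta n (j k : 'I_(dimt a n)) (l m : 'I_(dimt b n)) u v :
  product_rep (mt_tens T (uhf_in Aa n (delta_mx j k)) (uhf_in Ab n (delta_mx l m)))
    (ell2_tensor u v) =
  ell2_tensor (pi1 (uhf_in Aa n (delta_mx j k)) u) (pi2 (uhf_in Ab n (delta_mx l m)) v).
Proof.
by rewrite -phi_delta push_repE !basis_rep_delta mxunit_tensor.
Qed.

Lemma in_one_sum c (A : uhf R c) n : \sum_j uhf_in A n (delta_mx j j) = 1.
Proof. by rewrite -linear_sum /= -mx1_sum_delta uhf_in_one. Qed.

Lemma rnorm_tensor (u : ell2 R I) (v : ell2 R J) :
  rnorm (ell2_tensor u v) = rnorm u * rnorm v.
Proof. exact: (hilbert_tensor_norm u v (@ell2_tensor_hilbert R I J)). Qed.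

(** Each slice of the representation is compared with the factor by
    [intertwine]. The unit of the other algebra is a sum of diagonal matrix
    units, so that the formula for matrix units applies. *)
Lemma product_repE x y u v :
  product_rep (mt_tens T x y) (ell2_tensor u v) = ell2_tensor (pi1 x u) (pi2 y v).
Proof.
have tsumr (u' : ell2 R I) (K : finType) (F : K -> ell2 R J) :
    ell2_tensor u' (\sum_j F j) = \sum_j ell2_tensor u' (F j).
  exact: (big_morph (ell2_tensor u') (ell2_tensorDr u') (ell2_tensor0r u')).
have tsuml (v' : ell2 R J) (K : finType) (F : K -> ell2 R I) :
    ell2_tensor (\sum_j F j) v' = \sum_j ell2_tensor (F j) v'.
  exact: (big_morph (fun w => ell2_tensor w v')
    (fun f f' => ell2_tensorDl f f' v') (ell2_tensor0l v')).
have left x' u' v' : product_rep (mt_tens T x' 1) (ell2_tensor u' v') =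
    ell2_tensor (pi1 x' u') v'.
  apply/esym; apply: (@intertwine R a Aa pi1 (slicel product_rep)
    (fun w => ell2_tensor w v') (rnorm v')) => [|w|n j k w].
  - exact: ell2_tensor_linearl.
  - by rewrite rnorm_tensor mulrC.
  - rewrite -[RHS]/(product_rep (mt_tens T _ 1) _) -(in_one_sum Ab n).
    rewrite tens_sumr rep_sum; under [RHS]eq_bigr do rewrite product_rep_delta.
    rewrite -tsumr -(@rep_sum _ _ pi2 _ (fun l => uhf_in Ab n (delta_mx l l))).
    by rewrite in_one_sum rep_one.
have right y' u' v' : product_rep (mt_tens T 1 y') (ell2_tensor u' v') =
    ell2_tensor u' (pi2 y' v').
  apply/esym; apply: (@intertwine R b Ab pi2 (slicer product_rep)
    (fun w => ell2_tensor u' w) (rnorm u')) => [|w|n j k w].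
  - exact: ell2_tensor_linearr.
  - by rewrite rnorm_tensor.
  - rewrite -[RHS]/(product_rep (mt_tens T 1 _) _) -(in_one_sum Aa n).
    rewrite tens_suml rep_sum; under [RHS]eq_bigr do rewrite product_rep_delta.
    rewrite -tsuml -(@rep_sum _ _ pi1 _ (fun l => uhf_in Aa n (delta_mx l l))).
    by rewrite in_one_sum rep_one.
rewrite -[x in mt_tens T x y]mulr1 -[y in mt_tens T _ y]mul1r.
by rewrite -mt_mul rep_mul right left.
Qed.

Lemma product_repP : is_tensor_rep (mt_tens T) pi1 pi2 product_rep.
Proof.
exists (@ell2_tensor R I J); split; first exact: ell2_tensor_hilbert.
exact: product_repE.
Qed.

End TensorRep.

(** * Vector states and disjointness *)

Section VectorStates.
Context {R : realType} {A : cstarAlgType R}.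
Local Notation C := R[i].

Definition vector_state (pi : rep A) (u : rep_space pi) : A -> C :=
  fun x => dot u (pi x u).

Lemma vector_stateP (pi : rep A) (u : rep_space pi) :
  dot u u = 1 -> is_state (vector_state u).
Proof.
move=> u1; split.
- by move=> c x y; rewrite /vector_state rep_linear dotDr dotZr.
- by move=> x; rewrite /vector_state rep_mul -rep_star starK dot_ge0.
- by rewrite /vector_state rep_one.
Qed.

Lemma unitary_equiv_refl (pi : rep A) : unitary_equiv pi pi.
Proof. by exists idfun; split=> //; exists idfun. Qed.

End VectorStates.

Section BasisVectors.
Context {R : realType}.

Lemma dot_basis (I : choiceType) (x : I) : dot (basis x : ell2 R I) (basis x) = 1.
Proof. by rewrite dot_rnorm basis_norm expr1n. Qed.

Lemma mxunit_basis c (I : indexing c) n (j : 'I_(dimt c n)) (x : I) :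
  mxunit j j (basis x : ell2 R I) = if idx (dig x) n == j then basis x else 0.
Proof.
apply: ell2_ext => y; rewrite -[LHS]/(mxunit_fun _ _ _ _) /mxunit_fun.
have [yj|yj] := eqVneq (idx (dig y) n) j.
  rewrite upd_same ?digitsK//; case: eqVneq => [//|xj].
  rewrite -[RHS]/(0 : R[i]) /= /basis_fun; case: eqP => // xy.
  by rewrite xy yj eqxx in xj.
case: eqP => // xj; rewrite /= /basis_fun; case: eqP => // xy.
by rewrite -xy xj eqxx in yj.
Qed.

End BasisVectors.

Lemma orthogonal_to_tensors (R : realType) (H K L : hilbertType R) (t : H -> K -> L) w :
  is_hilbert_tensor t -> (forall u v, dot w (t u v) = 0) -> w = 0.
Proof.
move=> [_ _ _ t_dense] wt; apply/rnorm_eq0/eqP.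
rewrite -sqrf_eq0 eq_le exprn_ge0 ?rnorm_ge0// andbT.
apply: (@le_of_small R _ _ (rnorm w)) => e e0; rewrite add0r.
have e0' : 0 < (e%:C : R[i]) by rewrite ltcR.
have [||z [wz [s zs]]] := t_dense (ball w e%:C).
- by exists w; exact: ballxx.
- exact: ball_open.
have -> : rnorm w ^+ 2 = rnorm (dot w (w - z)).
  rewrite dotDr dotNr [dot w z](_ : _ = 0).
    by rewrite subr0 dot_rnorm rnorm_real// exprn_ge0// rnorm_ge0.
  rewrite zs (big_morph (dot w) (dotDr w) (dot0r w)) big1// => p _; exact: wt.
apply: le_trans (dot_CauchySchwarz _ _) _; rewrite mulrC ler_wpM2r ?rnorm_ge0//.
by move: wz; rewrite -ball_normE /= rnormE ltcR => /ltW.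
Qed.

Section Disjointness.
Context {R : realType} {a b : seq_ge2} {Aa : uhf R a} {Ab : uhf R b}.
Context {T : min_tensor Aa Ab}.
Variables (e e' : digit_seq a).
Hypothesis ee' : ~ tail_eq e' e.
Variables (rho1 : rep Aa) (rho2 : rep Ab) (sigma : rep T).
Hypothesis rho1_class : rep_class (basis_rep Aa (tail_indexing e')) rho1.
Hypothesis sigma_tensor : is_tensor_rep (mt_tens T) rho1 rho2 sigma.

Let p n : Aa := uhf_in Aa n (delta_mx (idx e n) (idx e n)).

(** The tensors u (x) v with u the image of a basis vector are killed by p_n
    (x) q_n for large n, and w is fixed by the self-adjoint p_n (x) q_n. *)
Lemma no_product_vector (q : nat -> Ab) w :
  (forall n, star (q n) = q n) ->
  (forall n, sigma (mt_tens T (p n) (q n)) w = w) -> w = 0.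
Proof.
move=> q_sa w_fix; have [t [t_hilb t_act]] := sigma_tensor.
have [U [U_bij U_dot U_act]] := rho1_class.
have t_norm u v := hilbert_tensor_norm u v t_hilb.
have [tlin _ _ _] := t_hilb.
have U_norm v : rnorm (U v) = rnorm v.
  apply/eqP; rewrite -(eqrXn2 (n := 2)) ?rnorm_ge0//; apply/eqP/complexI.
  by rewrite -!dot_rnorm U_dot.
have p_sa n : star (p n) = p n by rewrite -uhf_in_star conj_delta.
pose F v u := dot w (t u v).
have tD v u u' : t (u + u') v = t u v + t u' v.
  by have := tlin v 1 u u'; rewrite !scale1r.
have t0 v : t 0 v = 0 by apply: (addIr (t 0 v)); rewrite -tD !add0r.
have tZ v c u : t (c *: u) v = c *: t u v.
  by have := tlin v c u 0; rewrite t0 !addr0.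
have F_basis x v : F v (U (basis x)) = 0.
  have [n xn] : exists n, idx (dig x) n != idx e n.
    apply: contrapT => no; apply: ee'; have [N xN] := svalP x.
    exists N => i Ni; rewrite -(xN i Ni).
    apply/esym/(@idx_eq _ _ _ i.+1); last exact: ltnSn.
    by apply: contrapT => xi; apply: no; exists i.+1; apply/eqP.
  rewrite /F -[w in dot w _](w_fix n) -[mt_tens _ _ _]starK rep_star mt_star p_sa q_sa.
  by rewrite t_act -U_act basis_rep_delta mxunit_basis (negbTE xn) linear0 t0 dot0r.
apply: (orthogonal_to_tensors t_hilb) => u v.
have [V UV VU] := U_bij; rewrite -[u]VU; set f := V u.
apply: (@rnorm_small R _ _ (rnorm w * rnorm v)) => d d0.
have [s fs] := ell2_approx f d0; set g := \sum_(y <- s) _ in fs.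
have Fg : dot w (t (U g) v) = 0.
  rewrite linear_sum (big_morph (fun u => t u v) (tD v) (t0 v)).
  rewrite (big_morph (dot w) (dotDr w) (dot0r w)) big1// => y _.
  by rewrite linearZ tZ dotZr [dot _ _]F_basis mulr0.
(* g is a finite combination of basis vectors, so it contributes nothing. *)
have -> : dot w (t (U f) v) = dot w (t (U (f - g)) v).
  by rewrite linearB -[- U g]scaleN1r tD tZ scaleN1r dotDr dotNr Fg subr0.
apply: le_trans (dot_CauchySchwarz _ _) _; rewrite t_norm U_norm.
by rewrite mulrCA ler_wpM2r ?mulr_ge0 ?rnorm_ge0// ltW.
Qed.

End Disjointness.

Definition seq2 : seq_ge2 := SeqGe2 (fun=> leqnn 2).

Lemma digit01_neq n : (idx (@digit0 seq2) n.+1 == idx (@digit1 seq2) n.+1) = false.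
Proof. by apply/eqP => /idx_eq/(_ 0%N (ltn0Sn n))/(congr1 val). Qed.

Theorem corollary3p7 (R : realType)
  (A : forall a : seq_ge2, uhf R a)
  (T : forall a b : seq_ge2, min_tensor (A a) (A b))
  (phi : forall a b : seq_ge2, phi_iso (A (muls a b)) (T a b)) :
  (exists (a b : seq_ge2) (omega : A a -> R[i]) (omega' : A b -> R[i]),
     is_state omega /\ is_state omega' /\
     exists (tau : A (muls a b) -> R[i]) (tau' : A (muls b a) -> R[i]),
       [/\ is_phi_state (phi a b) omega omega' tau,
           is_phi_state (phi b a) omega' omega tau'
         & tau <> ecast c (A c -> R[i]) (mulsC b a) tau'])
  /\
  (exists (a b : seq_ge2) (C : rep (A a) -> Prop) (C' : rep (A b) -> Prop),
     is_rep_class C /\ is_rep_class C' /\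
     phi_class (phi a b) C C' <>
       ecast c (rep (A c) -> Prop) (mulsC b a) (phi_class (phi b a) C' C)).
Proof.
pose I0 := tail_indexing (@digit0 seq2); pose I1 := tail_indexing (@digit1 seq2).
pose x0 : I0 := tail_base _; pose x1 : I1 := tail_base _.
pose f := phi seq2 seq2.
pose pi0 := basis_rep (A seq2) I0; pose pi1 := basis_rep (A seq2) I1.
pose d0 : ell2 R I0 := basis x0; pose d1 : ell2 R I1 := basis x1.
split.
  exists seq2, seq2, (vector_state (pi := pi0) d0), (vector_state (pi := pi1) d1).
  split; first exact/vector_stateP/dot_basis.
  split; first exact/vector_stateP/dot_basis.
  pose s01 := vector_state (pi := product_rep f I0 I1) (ell2_tensor d0 d1).
  pose s10 := vector_state (pi := product_rep f I1 I0) (ell2_tensor d1 d0).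
  have dd (I J : choiceType) (x : I) (y : J) :
    dot (ell2_tensor (basis x : ell2 R I) (basis y : ell2 R J))
        (ell2_tensor (basis x) (basis y)) = 1.
    by rewrite ell2_tensor_dot !dot_basis mulr1.
  have s01E x y : s01 (mt_tens _ x y) =
      vector_state (pi := pi0) d0 x * vector_state (pi := pi1) d1 y.
    by rewrite /s01 /vector_state product_repE ell2_tensor_dot.
  have s10E x y : s10 (mt_tens _ x y) =
      vector_state (pi := pi1) d1 x * vector_state (pi := pi0) d0 y.
    by rewrite /s10 /vector_state product_repE ell2_tensor_dot.
  exists (s01 \o f), (s10 \o f); split.
  - by exists s01 => //; split; [exact/vector_stateP/dd | exact: s01E].
  - by exists s10 => //; split; [exact/vector_stateP/dd | exact: s10E].
  (* For a = b the transport along commutativity is the identity. *)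
  rewrite (Prop_irrelevance (mulsC seq2 seq2) erefl) /= => eq_s.
  pose j := idx (@digit0 seq2) 1; pose l := idx (@digit1 seq2) 1.
  have := congr1 (fun s => s (uhf_in _ 1 (delta_mx (join_idx j l) (join_idx j l)))) eq_s.
  rewrite /comp phi_delta s01E s10E /vector_state !basis_rep_delta !mxunit_basis.
  rewrite !eqxx [_ == j]eq_sym (digit01_neq 0) dot0r mul0r !dot_basis mulr1 => /eqP.
  by rewrite oner_eq0.
exists seq2, seq2, (rep_class pi0), (rep_class pi1).
split; first by exists pi0.
split; first by exists pi1.
rewrite (Prop_irrelevance (mulsC seq2 seq2) erefl) /= => eq_class.
pose sigma := product_rep f I0 I1.
have : phi_class f (rep_class pi0) (rep_class pi1) (rep_comp f sigma).
  exists pi0, pi1, sigma; split; try exact: unitary_equiv_refl.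
  exact: product_repP.
rewrite eq_class => -[rho1 [rho2 [sigma' [rho1_class _ sigma'P]]]].
move=> [U [[V UV VU] U_dot U_act]].
pose d := ell2_tensor d0 d1.
(* The equivalence carries V d to d, so V d is fixed by all p_n (x) q_n in
   the representation built in the other order. *)
have : V d = 0.
  apply: (no_product_vector (e := @digit0 seq2) _ rho1_class sigma'P
    (q := fun n => uhf_in (A seq2) n (delta_mx (idx digit1 n) (idx digit1 n)))).
  - by move=> [N /(_ N (leqnn N))/(congr1 val)].
  - by move=> n; rewrite -uhf_in_star conj_delta.
  move=> n; rewrite -(phi_delta f); apply: (can_inj UV).
  rewrite VU [LHS]U_act VU.
  rewrite -[LHS]/(sigma (f _) d) phi_delta product_repE !basis_rep_delta.
  by rewrite !mxunit_basis !eqxx.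
move=> /(congr1 U); rewrite VU linear0 => d_eq0.
have := ell2_tensor_dot d0 d1 d0 d1; rewrite -/d d_eq0 dot0r !dot_basis mulr1.
by move=> /esym/eqP; rewrite oner_eq0.
Qed.
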